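(* Let $T$ be a first-order theory in a countable language. Then $T$ has the SS-property if and only if $T$ has the D-property.
   Context: ''Submodel'' means (nonempty) substructure; $N \subseteq M$ means $N$ is a substructure of $M$. $T$ is model complete if for all $N, M \models T$, $N \subseteq M$ implies $N \preceq M$. - $T$ has the SS-property iff (i) for all $M_1, M_2 \models T$ and substructures $N_1 \subseteq M_1$, $N_2 \subseteq M_2$, every isomorphism $f: N_1 \to N_2$ extends to an isomorphism $f^*: N_1^* \to N_2^*$ where $N_1^* \subseteq M_1$, $N_2^* \subseteq M_2$ are substructures with $N_1^*, N_2^* \models T$; and (ii) $T$ is model complete (equivalently: for all $N, M \models T$ with $N \subseteq M$, every existential formula $\varphi(\bar x)$ and every $\bar b$ in $N$, $M \models \varphi(\bar b)$ iff $N \models \varphi(\bar b)$). - A $T$-closure of a structure $N$ is a model $N^* \models T$ with $N \subseteq N^*$ such that $N^*$ embeds over $N$ (by an embedding fixing $N$ pointwise) into every model of $T$ containing $N$ as a substructure. For $N \subseteq M$ and $a \in |M|$, $N + a$ denotes the smallest substructure of $M$ containing $|N| \cup \{a\}$. - $T$ has the D-property iff (i) every structure $N$ that is a substructure of some model of $T$ has a $T$-closure; and (ii) whenever $N, M \models T$ and $N \subsetneq M$, there is $a \in |M| \setminus |N|$ such that $N + a$ embeds over $N$ into some elementary extension of $N$. *)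

(* Defs.v *)
From mathcomp Require Import all_boot.

Set Implicit Arguments.
Unset Strict Implicit.
Unset Printing Implicit Defensive.

(* Constants are the function symbols of arity 0. *)
Record language := Language {
  fsym : Type;
  farity : fsym -> nat;
  rsym : Type;
  rarity : rsym -> nat }.

(* At most countable: finite sets of symbols are allowed. *)
Definition countable_language (L : language) : Prop :=
  (exists c : fsym L -> nat, injective c) /\
  (exists c : rsym L -> nat, injective c).

Inductive term (L : language) : Type :=
| Var of nat
| App (f : fsym L) of ('I_(farity f) -> term L).

Inductive formula (L : language) : Type :=
| Bot
| Eq of term L & term L
| Rel (r : rsym L) of ('I_(rarity r) -> term L)
| Imp of formula L & formula L
| All of nat & formula L.

Arguments Var {L}.
Arguments Bot {L}.

Fixpoint occurs (L : language) (x : nat) (t : term L) : Prop :=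
  match t with
  | Var y => x = y
  | App _ a => exists i, occurs x (a i)
  end.

Fixpoint free (L : language) (x : nat) (p : formula L) : Prop :=
  match p with
  | Bot => False
  | Eq s t => occurs x s \/ occurs x t
  | Rel _ a => exists i, occurs x (a i)
  | Imp p q => free x p \/ free x q
  | All y p => x <> y /\ free x p
  end.

Definition sentence (L : language) (p : formula L) : Prop :=
  forall x, ~ free x p.

Record theory (L : language) := Theory {
  axiom_of :> formula L -> Prop;
  theory_sentence : forall p, axiom_of p -> sentence p }.

Record structure (L : language) := Structure {
  carrier :> Type;
  carrier_inhabited : inhabited carrier;
  fint : forall f : fsym L, ('I_(farity f) -> carrier) -> carrier;
  rint : forall r : rsym L, ('I_(rarity r) -> carrier) -> Prop }.

Arguments fint {L} s f a.
Arguments rint {L} s r a.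

Definition update (D : Type) (v : nat -> D) (x : nat) (d : D) : nat -> D :=
  fun y => if y == x then d else v y.

Fixpoint eval (L : language) (M : structure L) (v : nat -> M) (t : term L) : M :=
  match t with
  | Var x => v x
  | App f a => fint M f (fun i => eval v (a i))
  end.

Fixpoint sat (L : language) (M : structure L) (v : nat -> M) (p : formula L) :
    Prop :=
  match p with
  | Bot => False
  | Eq s t => eval v s = eval v t
  | Rel r a => rint M r (fun i => eval v (a i))
  | Imp p q => sat v p -> sat v q
  | All x p => forall d : M, sat (update v x d) p
  end.

Definition model (L : language) (T : theory L) (M : structure L) : Prop :=
  forall p, T p -> forall v : nat -> M, sat v p.

Definition embedding (L : language) (M N : structure L) (h : M -> N) : Prop :=
  [/\ injective h,
      forall f a, h (fint M f a) = fint N f (fun i => h (a i)) &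
      forall r a, rint M r a <-> rint N r (fun i => h (a i))].

Definition isomorphism (L : language) (M N : structure L) (h : M -> N) : Prop :=
  embedding h /\ bijective h.

(* A tuple of parameters is given by a valuation of all the variables; only the
   values at the free variables of the formula matter. *)
Definition elementary_embedding (L : language) (M N : structure L)
    (h : M -> N) : Prop :=
  embedding h /\
  forall (p : formula L) (v : nat -> M), sat v p <-> sat (fun x => h (v x)) p.

Definition fclosed (L : language) (M : structure L) (A : M -> Prop) : Prop :=
  forall f a, (forall i, A (a i)) -> A (fint M f a).

Record substructure (L : language) (M : structure L) := Substructure {
  smem :> M -> Prop;
  smem_nonempty : exists x, smem x;
  smem_closed : fclosed smem }.

Definition induced (L : language) (M : structure L) (N : substructure M) :
    structure L :=
  @Structure L {x : M | N x}
    (let: ex_intro x Nx := smem_nonempty N in inhabits (exist _ x Nx))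
    (fun f a => exist _ (fint M f (fun i => sval (a i)))
                  (smem_closed (fun i => svalP (a i))))
    (fun r a => rint M r (fun i => sval (a i))).

Coercion induced : substructure >-> structure.

Definition val_of (L : language) (M : structure L) (N : substructure M) :
  N -> M := sval.

Definition included (L : language) (M : structure L) (N N' : substructure M) :
  Prop := forall x, N x -> N' x.

Definition proper (L : language) (M : structure L) (N : substructure M) : Prop :=
  exists x, ~ N x.

Definition model_complete (L : language) (T : theory L) : Prop :=
  forall (M : structure L) (N : substructure M),
    model T M -> model T N -> elementary_embedding (@val_of L M N).

Definition SS_property (L : language) (T : theory L) : Prop :=
  (forall (M1 M2 : structure L) (N1 : substructure M1) (N2 : substructure M2)
     (f : N1 -> N2),
     model T M1 -> model T M2 -> isomorphism f ->
     exists (N1' : substructure M1) (N2' : substructure M2) (f' : N1' -> N2'),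
       [/\ included N1 N1' /\ included N2 N2',
           model T N1' /\ model T N2',
           isomorphism f' &
           forall (x : N1) (x' : N1'),
             val_of x' = val_of x -> val_of (f' x') = val_of (f x)]) /\
  model_complete T.

(* N* is an extension of N, and M a model containing N, through the embeddings
   e : N -> N* and g : N -> M; being over N means commuting with these. *)
Definition T_closure (L : language) (T : theory L) (N N' : structure L)
    (e : N -> N') : Prop :=
  [/\ model T N', embedding e &
      forall (M : structure L) (g : N -> M),
        model T M -> embedding g ->
        exists h : N' -> M, embedding h /\ forall x, h (e x) = g x].

Definition generated (L : language) (M : structure L) (X : M -> Prop) :
    M -> Prop :=
  fun x => forall A : M -> Prop, fclosed A -> (forall y, X y -> A y) -> A x.

Lemma generated_sub (L : language) (M : structure L) (X : M -> Prop) (x : M) :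
  X x -> generated X x.
Proof. by move=> Xx A _; apply. Qed.

Lemma generated_closed (L : language) (M : structure L) (X : M -> Prop) :
  fclosed (generated X).
Proof. by move=> f a ga A clA XA; apply: (clA) => i; apply: ga. Qed.

Definition adjoin (L : language) (M : structure L) (N : substructure M)
    (a : M) : substructure M :=
  @Substructure L M (generated (fun x => N x \/ x = a))
    (ex_intro _ a (generated_sub (or_intror erefl)))
    (@generated_closed L M (fun x => N x \/ x = a)).

Definition D_property (L : language) (T : theory L) : Prop :=
  (forall (M : structure L) (N : substructure M),
     model T M -> exists (N' : structure L) (e : N -> N'), T_closure T e) /\
  (forall (M : structure L) (N : substructure M),
     model T M -> model T N -> proper N ->
     exists a : M, ~ N a /\
     exists (N' : structure L) (e : N -> N') (h : adjoin N a -> N'),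
       [/\ elementary_embedding e, embedding h &
           forall (x : N) (y : adjoin N a), val_of y = val_of x -> h y = e x]).

(* Main.v *)
(* From D to SS.  A model N of T is existentially closed in every model M
   containing it: among the substructures of M in which N is existentially
   closed take a maximal one A.  As A embeds over N into an ultrapower of N, so
   does its T-closure, whose copy in M must be A; so A is a model, and (ii)
   together with the T-closure of A + a would enlarge A if A were not M.  Hence
   M embeds over N into an ultrapower of N for all models N of T contained in
   M, and model completeness follows by induction on formulas.

   From SS to D.  Two models of T containing N have isomorphic elementary
   submodels containing N, so they satisfy the same formulas over N.  If N is
   countable, the isolated types over N are dense below every formula p:
   otherwise a simultaneous Henkin construction yields two models of T
   containing N in which no realization of p in the first has the type over N of
   an element of the second, whereas the submodels they share contain
   realizations of p.  Density for arbitrary N reflects to countable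
   substructures.  Adjoining isolated elements transfinitely inside a model M
   gives an elementary submodel of M, and an embedding of N into a model of T
   extends along this construction. *)

From mathcomp Require Import all_boot.
From mathcomp Require Import boolp classical_sets filter.
Require Import Defs.

Set Implicit Arguments.
Unset Strict Implicit.
Unset Printing Implicit Defensive.

Local Open Scope classical_set_scope.

(** * Formulas and valuations *)

Definition Not (L : language) (p : formula L) : formula L := Imp p Bot.
Definition And (L : language) (p q : formula L) : formula L :=
  Not (Imp p (Not q)).
Definition Ex (L : language) (x : nat) (p : formula L) : formula L :=
  Not (All x (Not p)).

Section Formulas.
Variables (L : language) (M : structure L).
Implicit Types (p q : formula L) (t : term L) (u v w : nat -> M).

Lemma sat_and v p q : sat v (And p q) <-> sat v p /\ sat v q.
Proof.
split=> [/= h|[hp hq] /= h]; last exact: h.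
by split; apply: contrapT => n; apply: h => // hp hq; apply: n.
Qed.

Lemma sat_ex v x p : sat v (Ex x p) <-> exists d, sat (update v x d) p.
Proof.
split=> [/= h|[d hd] /= h]; last exact: h hd.
by apply: contrapT => n; apply: h => d hd; apply: n; exists d.
Qed.

Fixpoint tbound t : nat :=
  match t with
  | Var x => x.+1
  | App f a => \max_(i < farity f) tbound (a i)
  end.

Fixpoint vbound p : nat :=
  match p with
  | Bot => 0
  | Eq s t => maxn (tbound s) (tbound t)
  | Rel r a => \max_(i < rarity r) tbound (a i)
  | Imp p q => maxn (vbound p) (vbound q)
  | All x p => maxn x.+1 (vbound p)
  end.

Lemma eval_free t v w :
  (forall z, occurs z t -> v z = w z) -> eval v t = eval w t.
Proof.
elim: t => [x|f a IH] /= h; first exact: h.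
by congr (fint M f); apply: funext => i; apply: IH => z zi; apply: h; exists i.
Qed.

Lemma sat_free p v w :
  (forall z, free z p -> v z = w z) -> (sat v p <-> sat w p).
Proof.
elim: p v w => [|s t|r a|p IHp q IHq|x p IHp] v w /= h //.
- by rewrite (@eval_free s v w) ?(@eval_free t v w) // => z zb; apply: h;
    [right|left].
- suff -> : (fun i => eval v (a i)) = (fun i => eval w (a i)) by [].
  by apply: funext => i; apply: eval_free => z zi; apply: h; exists i.
- by rewrite (IHp v w) ?(IHq v w) // => z zb; apply: h; [right|left].
- have e d : sat (update v x d) p <-> sat (update w x d) p.
    apply: IHp => z zb; rewrite /update; case: eqP => // zx.
    exact: h.
  by split=> h' d; apply/e.
Qed.

Lemma occurs_tbound z t : occurs z t -> z < tbound t.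
Proof.
elim: t => [x ->//|f a IH] /= [i /IH /leq_trans]; apply.
exact: (leq_bigmax (F := fun i => tbound (a i))).
Qed.

Lemma free_vbound z p : free z p -> z < vbound p.
Proof.
elim: p => [|s t|r a|p IHp q IHq|x p IHp] //=.
- by rewrite leq_max => -[] /occurs_tbound ->; rewrite ?orbT.
- move=> [i /occurs_tbound /leq_trans]; apply.
  exact: (leq_bigmax (F := fun i => tbound (a i))).
- by rewrite leq_max => -[/IHp|/IHq] ->; rewrite ?orbT.
- by rewrite leq_max => -[_ /IHp ->]; rewrite orbT.
Qed.

Lemma sat_eq_in p v w :
  (forall z, z < vbound p -> v z = w z) -> (sat v p <-> sat w p).
Proof. by move=> h; apply: sat_free => z /free_vbound/h. Qed.

Lemma sat_eq v w p : v =1 w -> sat v p -> sat w p.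
Proof. by move=> /funext ->. Qed.

Fixpoint tren (r : nat -> nat) t : term L :=
  match t with
  | Var x => Var (r x)
  | App f a => App (fun i => tren r (a i))
  end.

(* The bound variable is renamed to one that differs from the images of all
   the variables of the body, so [r] need not be injective. *)
Fixpoint ren (r : nat -> nat) p : formula L :=
  match p with
  | Bot => Bot
  | Eq s t => Eq (tren r s) (tren r t)
  | Rel k a => Rel (fun i => tren r (a i))
  | Imp p q => Imp (ren r p) (ren r q)
  | All x p =>
      let y := (\max_(z < vbound p) r z).+1 in
      All y (ren (fun z => if z == x then y else r z) p)
  end.

Lemma eval_ren r t w : eval w (tren r t) = eval (fun z => w (r z)) t.
Proof.
by elim: t => [x|f a IH] //=; congr (fint M f); apply: funext => i; apply: IH.
Qed.

Lemma sat_ren r p w : sat w (ren r p) <-> sat (fun z => w (r z)) p.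
Proof.
elim: p r w => [|s t|k a|p IHp q IHq|x p IHp] r w //=.
- by rewrite !eval_ren.
- suff -> : (fun i => eval w (tren r (a i))) =
            (fun i => eval (fun z => w (r z)) (a i)) by [].
  by apply: funext => i; apply: eval_ren.
- by rewrite IHp IHq.
- set y := _.+1.
  have e d : sat (update w y d) (ren (fun z => if z == x then y else r z) p) <->
             sat (update (fun z => w (r z)) x d) p.
    rewrite IHp; apply: sat_eq_in => z zb; rewrite /update.
    case: (z == x); first by rewrite eqxx.
    rewrite ifN // neq_ltn ltnS.
    by rewrite (leq_bigmax (F := fun i : 'I_(vbound p) => r i) (Ordinal zb)).
  by split=> h d; apply/e.
Qed.

Fixpoint qfree p : Prop :=
  match p with
  | Imp p q => qfree p /\ qfree q
  | All _ _ => False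
  | _ => True
  end.

Lemma qfree_ren r p : qfree p -> qfree (ren r p).
Proof. by elim: p r => //= p IHp q IHq r [/IHp ? /IHq ?]; split. Qed.

Definition exs (Q : pred nat) p : formula L :=
  foldr (@Ex L) p [seq z <- iota 0 (vbound p) | Q z].

Lemma sat_exs Q p w :
  sat w (exs Q p) <-> exists w', (forall z, ~~ Q z -> w' z = w z) /\ sat w' p.
Proof.
suff foldrP (s : seq nat) v : sat v (foldr (@Ex L) p s) <->
    exists w', (forall z, z \notin s -> w' z = v z) /\ sat w' p.
  rewrite /exs foldrP; split=> -[w' [ew' pw']].
    exists w'; split=> // z nQz; apply: ew'.
    by rewrite mem_filter (negPf nQz).
  exists (fun z => if z < vbound p then w' z else w z); split.
    move=> z; rewrite mem_filter mem_iota add0n /= negb_and.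
    by case: ltnP => // _ /orP[] // /ew'.
  by apply: (proj1 (sat_eq_in _)) pw' => z ->.
elim: s v => [|x s IH] v.
  split=> [pv|[w' [ew' pw']]]; first by exists v.
  by apply: sat_eq pw' => z; apply: ew'.
rewrite [foldr _ _ _]/(Ex x (foldr (@Ex L) p s)) sat_ex.
split=> [[d /IH[w' [ew' pw']]]|[w' [ew' pw']]].
  exists w'; split=> // z; rewrite inE negb_or => /andP[zx zs].
  by rewrite ew' // /update (negPf zx).
exists (w' x); apply/IH; exists w'; split=> // z zs; rewrite /update.
by case: eqP => [->//|/eqP zx]; apply: ew'; rewrite inE negb_or zx.
Qed.

End Formulas.

(** * Pairing and shifting of valuations *)

Section Valuations.
Variable D : Type.

Definition scons (d : D) (v : nat -> D) : nat -> D :=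
  fun z => if z is z'.+1 then v z' else d.

Definition merge (u v : nat -> D) : nat -> D :=
  fun z => if odd z then v z./2 else u z./2.

Lemma merge_even u v z : merge u v z.*2 = u z.
Proof. by rewrite /merge odd_double doubleK. Qed.

Lemma merge_odd u v z : merge u v z.*2.+1 = v z.
Proof. by rewrite /merge /= odd_double /= uphalf_double. Qed.

End Valuations.

Lemma comp_merge (D E : Type) (h : D -> E) (u v : nat -> D) :
  (fun z => h (merge u v z)) = merge (fun z => h (u z)) (fun z => h (v z)).
Proof. by apply: funext => z; rewrite /merge; case: ifP. Qed.

Lemma comp_scons (D E : Type) (h : D -> E) (d : D) (v : nat -> D) :
  (fun z => h (scons d v z)) = scons (h d) (fun z => h (v z)).
Proof. by apply: funext => -[]. Qed.

Lemma comp_update (D E : Type) (h : D -> E) (v : nat -> D) x d :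
  (fun z => h (update v x d z)) = update (fun z => h (v z)) x (h d).
Proof. by apply: funext => z; rewrite /update; case: ifP. Qed.

Definition pad (D : Type) (d : D) n (a : 'I_n -> D) : nat -> D :=
  fun z => if insub z is Some i then a i else d.

Lemma padE (D : Type) (d : D) n (a : 'I_n -> D) (i : 'I_n) : pad d a i = a i.
Proof. by rewrite /pad valK. Qed.

Section FormulaRenamings.
Variables (L : language) (M : structure L).
Implicit Types (p q : formula L) (u v w : nat -> M) (d : M).

Definition focus (x : nat) p : formula L :=
  ren (fun z => if z == x then 0 else z.+1) p.

Lemma sat_focus x p d v : sat (scons d v) (focus x p) <-> sat (update v x d) p.
Proof.
rewrite sat_ren; set f := fun z => _; set g := update _ _ _.
suff -> : f = g by [].
by apply: funext => z; rewrite /f /g /update; case: eqP.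
Qed.

Definition ex0 p : formula L := ren predn (Ex 0 p).

Lemma sat_ex0 p v : sat v (ex0 p) <-> exists d, sat (scons d v) p.
Proof.
rewrite sat_ren sat_ex; suff e d : update (fun z => v z.-1) 0 d = scons d v.
  by split=> -[d h]; exists d; [rewrite -e|rewrite e].
by apply: funext => -[].
Qed.

Definition ren0 (k : nat) (r : nat -> nat) p : formula L :=
  ren (fun z => if z is z'.+1 then r z' else k) p.

Lemma sat_ren0 k r p w :
  sat w (ren0 k r p) <-> sat (scons (w k) (fun z => w (r z))) p.
Proof.
rewrite sat_ren; set f := fun z => _; set g := scons _ _.
by suff -> : f = g by []; apply: funext => -[].
Qed.

End FormulaRenamings.

(** * Embeddings and elementary submodels *)

Lemma sval_inj (X : Type) (P : X -> Prop) (x y : {x | P x}) :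
  sval x = sval y -> x = y.
Proof.
case: x y => [x Px] [y Py] /= e; case: _ / e in Py *.
by congr exist; apply: Prop_irrelevance.
Qed.

Section Embeddings.
Variable L : language.
Implicit Types (M N K : structure L).

Lemma eval_embedding M N (h : M -> N) (v : nat -> M) t :
  embedding h -> h (eval v t) = eval (fun z => h (v z)) t.
Proof.
move=> [_ hf _]; elim: t => [x|f a IH] //=.
by rewrite hf; congr (fint N f); apply: funext => i; apply: IH.
Qed.

Lemma sat_qfree M N (h : M -> N) (v : nat -> M) p :
  embedding h -> qfree p -> sat v p <-> sat (fun z => h (v z)) p.
Proof.
move=> eh; have [hi _ hr] := eh.
elim: p => [|s t|r a|p IHp q IHq|x p IHp] //=.
- rewrite -!eval_embedding //; split=> [->//|]; exact: hi.
- rewrite hr; set f := fun i => _; set g := fun i => _.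
  by suff -> : f = g by []; apply: funext => i; apply: eval_embedding.
- by move=> [/IHp -> /IHq ->].
Qed.

Lemma surjective_embedding_elementary M N (h : M -> N) :
  embedding h -> (forall y, exists x, h x = y) -> elementary_embedding h.
Proof.
move=> eh sh; split=> // p; elim: p => [|s t|r a|p IHp q IHq|x p IHp] v.
- by [].
- exact: sat_qfree.
- exact: sat_qfree.
- by rewrite /= IHp IHq.
- have e d : sat (update v x d) p <->
             sat (update (fun z => h (v z)) x (h d)) p.
    by rewrite IHp comp_update.
  split=> /= hp d; last exact/e.
  by have [d' <-] := sh d; apply/e.
Qed.

Lemma embedding_comp M N K (h : M -> N) (g : N -> K) :
  embedding h -> embedding g -> embedding (fun x => g (h x)).
Proof.
move=> [hi hf hr] [gi gf gr]; split=> [x y /gi/hi//|f a|r a].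
  by rewrite hf gf.
by rewrite hr gr.
Qed.

Lemma val_embedding M (N : substructure M) : embedding (@val_of L M N).
Proof.
by split=> // x y; apply: sval_inj.
Qed.

Lemma elementary_comp M N K (h : M -> N) (g : N -> K) :
  elementary_embedding h -> elementary_embedding g ->
  elementary_embedding (fun x => g (h x)).
Proof.
move=> [eh hh] [eg hg]; split; first exact: embedding_comp.
by move=> p v; rewrite hh hg.
Qed.

Lemma model_elementary (T : theory L) M N (h : M -> N) :
  elementary_embedding h -> model T M <-> model T N.
Proof.
move=> [_ eh]; split=> mT p Tp v; last exact/eh/mT.
have [d] := carrier_inhabited M.
have /eh := mT p Tp (fun => d); apply: (proj1 (sat_free _)) => z.
by move/(theory_sentence Tp).
Qed.

Section Image.
Variables (N M : structure L) (g : N -> M).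
Hypothesis eg : embedding g.

Lemma image_nonempty : exists y, (exists x, g x = y).
Proof. by have [x] := carrier_inhabited N; exists (g x), x. Qed.

Lemma image_closed : fclosed (fun y => exists x, g x = y).
Proof.
move=> f a /choice[b hb]; exists (fint N f b); have [_ -> _] := eg.
by congr (fint M f); apply: funext.
Qed.

Definition image_sub : substructure M :=
  Substructure image_nonempty image_closed.

Definition to_image (x : N) : image_sub := exist _ (g x) (ex_intro _ x erefl).

Lemma to_image_embedding : embedding to_image.
Proof.
have [gi gf gr] := eg; split; [by move=> x y [/gi]| |exact: gr].
by move=> f a; apply: sval_inj; apply: gf.
Qed.

Lemma to_image_surj y : exists x, to_image x = y.
Proof. by case: y => y [x e]; exists x; apply: sval_inj. Qed.

Lemma to_image_elementary : elementary_embedding to_image.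
Proof.
apply: surjective_embedding_elementary; first exact: to_image_embedding.
exact: to_image_surj.
Qed.

End Image.

(** The Tarski-Vaught criterion, stated for sets because closure of a nonempty set under the
    function symbols follows from it. *)
Definition tv_closed M (A : set M) :=
  forall p (v : nat -> M), (forall z, A (v z)) ->
    (exists d, sat (scons d v) p) -> exists d, A d /\ sat (scons d v) p.

Definition graph_formula (f : fsym L) : formula L :=
  Eq (Var 0) (App (fun i : 'I_(farity f) => Var i.+1)).

Lemma sat_graph M f (a : 'I_(farity f) -> M) d0 d :
  sat (scons d (pad d0 a)) (graph_formula f) <-> d = fint M f a.
Proof.
rewrite /=; set b := fun i => _; suff -> : b = a by [].
by apply: funext => i; apply: padE.
Qed.

Lemma pad_in M (A : set M) n (a : 'I_n -> M) d :
  A d -> (forall i, A (a i)) -> forall z, A (pad d a z).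
Proof. by move=> Ad Aa z; rewrite /pad; case: insub. Qed.

Lemma tv_closed_fclosed M (A : set M) d : A d -> tv_closed A -> @fclosed L M A.
Proof.
move=> Ad tv f a Aa; have [|y [Ay /sat_graph <-//]] :=
  tv (graph_formula f) (pad d a) (pad_in Ad Aa).
by exists (fint M f a); apply/sat_graph.
Qed.

Lemma tarski_vaught M (A : substructure M) :
  tv_closed A -> elementary_embedding (@val_of L M A).
Proof.
move=> tv; have ev := val_embedding A; split=> // p.
elim: p => [|s t|r a|p IHp q IHq|x p IHp] v.
- by [].
- exact: sat_qfree.
- exact: sat_qfree.
- by rewrite /= IHp IHq.
- have e d : sat (update v x d) p <->
             sat (update (fun z => val_of (v z)) x (val_of d)) p.
    by rewrite IHp comp_update.
  split=> /= hp; last by move=> d; apply/e.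
  apply: contrapT => /existsNP[d nd].
  have [|d' [Ad' /sat_focus nd']] :=
      tv (focus x (Not p)) (fun z => val_of (v z)) (fun z => svalP (v z)).
    by exists d; apply/sat_focus.
  exact/nd'/(e (exist _ d' Ad'))/hp.
Qed.

End Embeddings.

(** * Canonical choices, Zorn's lemma and chains of sets *)

Section Choose.
Variable X : Type.

Definition pick_of (P : X -> Prop) (h : exists x, P x) : X := sval (cid h).

Lemma pick_ofP (P : X -> Prop) (h : exists x, P x) : P (pick_of h).
Proof. exact: (svalP (cid h)). Qed.

(** Equivalent predicates are equal, so the choice depends only on the class; this gives canonical
    representatives in the ultrapower. *)
Lemma pick_of_ext (P Q : X -> Prop) (hP : exists x, P x) (hQ : exists x, Q x) :
  (forall x, P x <-> Q x) -> pick_of hP = pick_of hQ.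
Proof.
move=> /predeqP PQ; case: _ / PQ in hQ *.
by congr pick_of; apply: Prop_irrelevance.
Qed.

(** The empty chain, about which the hypothesis says nothing, is handled by admitting the empty set
    besides the members of [P]; a maximal set that is empty must then equal [A0]. *)
Lemma Zorn_chain (P : set (set X)) (A0 : set X) : P A0 ->
  (forall F : set (set X), F !=set0 -> F `<=` P -> total_on F subset ->
     P (\bigcup_(A in F) A)) ->
  exists A, P A /\ forall B, A `<=` B -> P B -> B `<=` A.
Proof.
move=> PA0 ch; pose Q A := A = set0 \/ P A.
have [F FQ Ftot|A [QA Amax]] := @Zorn_bigcup X Q.
  pose G := [set A | F A /\ P A].
  have [[A GA]|nG] := pselect (G !=set0).
    right; have -> : \bigcup_(A in F) A = \bigcup_(A in G) A.
      rewrite predeqE => x; split=> [[B FB Bx]|[B [FB _] Bx]]; exists B => //.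
      by split=> //; case: (FQ _ FB) => // B0; rewrite B0 in Bx.
    apply: ch; first by exists A.
      by move=> B [].
    by move=> B C [FB _] [FC _]; apply: Ftot.
  left; rewrite predeqE => x; split=> // -[B FB Bx]; exfalso; apply: nG; exists B.
  by split=> //; case: (FQ _ FB) => // B0; rewrite B0 in Bx.
have {}Amax B : A `<=` B -> P B -> B `<=` A.
  move=> AB PB; apply: contrapT => nBA; apply: (Amax B); last by right.
  by split.
exists A; split=> //; case: QA => // A_0.
suff <- : A0 = A by [].
by apply/seteqP; split; [apply: Amax => //|]; rewrite A_0.
Qed.

Lemma chain_finite (F : set (set X)) (n : nat) (a : 'I_n -> X) :
  F !=set0 -> total_on F subset -> (forall i, exists A, F A /\ A (a i)) ->
  exists A, F A /\ forall i, A (a i).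
Proof.
move=> [A0 FA0] Ftot; elim: n a => [|n IH] a ha; first by exists A0; split=> // -[].
have [A [FA hA]] := IH _ (fun i => ha (lift ord0 i)).
have [B [FB hB]] := ha ord0.
have [AB|BA] := Ftot _ _ FA FB.
  by exists B; split=> // i; case: (unliftP ord0 i) => [j|] ->; [apply/AB/hA|].
by exists A; split=> // i; case: (unliftP ord0 i) => [j|] ->; [|apply/BA].
Qed.

End Choose.

(** * Ultrapowers *)

Section Ultrapower.
Variables (L : language) (M : structure L) (I : Type) (U : set_system I).
Hypothesis UU : UltraFilter U.

Lemma ultra_not (A : set I) : ~ U A <-> U (~` A).
Proof.
split=> [nA|nA hA]; first by case: (in_ultra_setVsetC A UU).
by have /filter_ex[i []] : U (A `&` ~` A) by apply: filterI.
Qed.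

Let eqU (f g : I -> M) := U [set i | f i = g i].

Lemma eqU_exists f : exists g, eqU f g.
Proof. by exists f; apply: filterS filterT. Qed.

Definition rep (f : I -> M) : I -> M := pick_of (eqU_exists f).

Lemma rep_eqU f : eqU f (rep f).
Proof. exact: pick_ofP. Qed.

Lemma rep_ext f g : eqU f g -> rep f = rep g.
Proof.
move=> fg; apply: pick_of_ext => h.
by split; apply: filterS2 fg => i /= -> .
Qed.

(* A class of functions modulo [U] is represented by a chosen member. *)
Definition ultra_carrier := {f : I -> M | rep f = f}.

Definition cls (f : I -> M) : ultra_carrier :=
  exist _ (rep f) (esym (rep_ext (rep_eqU f))).

Lemma cls_eq f g : cls f = cls g <-> U [set i | f i = g i].
Proof.
split=> [[fg]|/rep_ext fg].
  by have := rep_eqU g; rewrite -fg; apply: filterS2 (rep_eqU f) => i /= ->.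
exact: sval_inj.
Qed.

Lemma clsK (a : ultra_carrier) : cls (sval a) = a.
Proof.
by apply: sval_inj; case: a.
Qed.

Lemma ultra_inhabited : inhabited ultra_carrier.
Proof. by have [d] := carrier_inhabited M; exists; apply: (cls (fun=> d)). Qed.

Definition ultrapower : structure L :=
  @Structure L ultra_carrier ultra_inhabited
    (fun f a => cls (fun i => fint M f (fun j => sval (a j) i)))
    (fun r a => U [set i | rint M r (fun j => sval (a j) i)]).

Lemma sval_cls n (h : 'I_n -> I -> M) :
  U [set i | (fun j => sval (cls (h j)) i) = (fun j => h j i)].
Proof.
have : U [set i | forall j, h j i = sval (cls (h j)) i].
  by apply: filter_forall => j; apply: rep_eqU.
by apply: filterS => i hi; apply: funext => j; rewrite -hi.
Qed.

Lemma eval_cls (g : nat -> I -> M) t :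
  @eval L ultrapower (fun z => cls (g z)) t =
  cls (fun i => eval (fun z => g z i) t).
Proof.
elim: t => [x|f a IH] //=; apply/cls_eq.
have := sval_cls (fun j i => eval (fun z => g z i) (a j)).
apply: filterS => i /= <-; congr (fint M f).
by apply: funext => j; rewrite IH.
Qed.

Lemma los (g : nat -> I -> M) p :
  @sat L ultrapower (fun z => cls (g z)) p <->
  U [set i | sat (fun z => g z i) p].
Proof.
elim: p g => [|s t|r a|p IHp q IHq|x p IHp] g.
- by split=> // /filter_ex[].
- by rewrite /= !eval_cls cls_eq.
- have e : U [set i | (fun j => sval (eval (M := ultrapower)
      (fun z => cls (g z)) (a j)) i) = (fun j => eval (fun z => g z i) (a j))].
    have := sval_cls (fun j i => eval (fun z => g z i) (a j)).
    by apply: filterS => i /= <-; apply: funext => j; rewrite eval_cls.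
  by split; apply: filterS2 e => i /= ->.
- rewrite /= IHp IHq; split=> [pq|pq hp]; last by apply: filterS2 pq hp => i; apply.
  have [hp|/ultra_not hp] := pselect (U [set i | sat (fun z => g z i) p]).
    by apply: filterS (pq hp) => i /= hq.
  by apply: filterS hp => i /= np.
- have e f : @sat L ultrapower (update (fun z => cls (g z)) x (cls f)) p <->
      U [set i | sat (update (fun z => g z i) x (f i)) p].
    rewrite -[update _ _ _](comp_update (@cls) g) IHp.
    suff -> : [set i | sat (fun z => update g x f z i) p] =
        [set i | sat (update (fun z => g z i) x (f i)) p] by [].
    by rewrite predeqE => i /=; rewrite (comp_update (fun h => h i)).
  split=> [h|h d /=]; last first.
    by rewrite -(clsK d); apply/e; apply: filterS h => i /=; apply.
  (* In each coordinate [f i] is a counterexample whenever there is one, so testing the class of [f]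
     suffices for the universal formula. *)
  have /choice[f hf] : forall i, exists d, sat (update (fun z => g z i) x d) p ->
      forall d, sat (update (fun z => g z i) x d) p.
    move=> i; have [a|/existsNP[d nd]] :=
      pselect (forall d, sat (update (fun z => g z i) x d) p); last by exists d.
    by have [d] := carrier_inhabited M; exists d.
  by have /e := h (cls f); apply: filterS => i /hf.
Qed.

Lemma ultrapower_diag :
  @elementary_embedding L M ultrapower (fun x => cls (fun=> x)).
Proof.
have h p (v : nat -> M) :
    sat v p <-> @sat L ultrapower (fun z => cls (fun=> v z)) p.
  rewrite los; split=> [hp|/filter_ex[]//]; exact: filterS filterT.
split=> //; split.
- by move=> x y /cls_eq/filter_ex[].
- move=> f a; apply/cls_eq.
  by apply: filterS (sval_cls (fun j i => a j)) => i /= ->.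
- move=> r a; split=> [ra|/= ra].
    by apply: filterS (sval_cls (fun j i => a j)) => i /= ->.
  have /filter_ex[] // : U [set i | rint M r a].
  by apply: filterS2 (sval_cls (fun j i => a j)) ra => i /= ->.
Qed.

End Ultrapower.

(** * The D-property implies the SS-property *)

Section ModelCompleteness.
Variable L : language.
Implicit Types M N K : structure L.

(** Negated atomic formulas are quantifier-free too, so preservation in one direction already yields
    injectivity and the reflection of relations. *)
Lemma qfree_embedding M K (f : M -> K) :
  (forall p (v : nat -> M), qfree p -> sat v p -> sat (fun z => f (v z)) p) ->
  embedding f.
Proof.
move=> h; split.
- move=> x y fxy; apply: contrapT => nxy.
  have /= := h (Not (Eq (Var 0) (Var 1))) (scons x (fun=> y)).
  by apply.
- move=> g a; have [d] := carrier_inhabited M.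
  pose p := Eq (Var 0) (App (fun i : 'I_(farity g) => Var i.+1)).
  have /= := h p (scons (fint M g a) (pad d a)) I.
  set b := fun i => pad d a _; have -> : b = a by apply: funext => i; apply: padE.
  move=> /(_ erefl) ->; congr (fint K g).
  by apply: funext => i; rewrite padE.
- move=> r a; have [d] := carrier_inhabited M.
  pose p := Rel (fun i : 'I_(rarity r) => @Var L i).
  have eM : (fun i : 'I_(rarity r) => pad d a i) = a.
    by apply: funext => i; apply: padE.
  have eK : (fun i : 'I_(rarity r) => f (pad d a i)) = (fun i => f (a i)).
    by apply: funext => i; rewrite padE.
  split; first by have /= := h p (pad d a) I; rewrite eM eK.
  move=> fa; apply: contrapT.
  by have /= := h (Not p) (pad d a) (conj I I); rewrite eM eK => h' /h'.
Qed.

(* The variables of [v] that carry the same value are identified before being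
   quantified existentially, so that their witnesses depend on the value only. *)
Lemma elementary_pullback M K (e : M -> K) (X : Type) (y : X -> K)
    (v : nat -> X) (u : nat -> M) p :
  elementary_embedding e ->
  sat (merge (fun z => y (v z)) (fun z => e (u z))) p ->
  exists m : X -> M, sat (merge (fun z => m (v z)) u) p.
Proof.
move=> [_ he] hp.
have /choice[idx hidx] : forall x, exists n, (exists z, v z = x) -> v n = x.
  move=> x; have [[z vz]|nx] := pselect (exists z, v z = x); first by exists z.
  by exists 0 => /nx.
have vidx z : v (idx (v z)) = v z by apply: hidx; exists z.
pose r z := if odd z then z else (idx (v z./2)).*2.
pose p' := exs (fun z => ~~ odd z) (ren r p).
have : sat (fun z => e (merge u u z)) p'.
  apply/sat_exs; exists (merge (fun z => y (v z)) (fun z => e (u z))); split.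
    by move=> z; rewrite negbK /merge => ->.
  apply/sat_ren; apply: sat_eq hp => z; rewrite /r.
  case: ifP => // oz; rewrite merge_even vidx.
  by rewrite /merge oz.
move=> /he /sat_exs[w' [ew']] /sat_ren hw'.
exists (fun x => w' (idx x).*2); apply: sat_eq hw' => z; rewrite /r.
by rewrite /merge; case: ifP => // oz; rewrite ew' ?oz // /merge oz.
Qed.

(* [N] is existentially closed in [A]; asking for a map [m] rather than a
   valuation makes the ultrapower of [N] over the index set [M -> N] usable. *)
Definition ec M (N : substructure M) (A : set M) :=
  forall p (v : nat -> M) (u : nat -> N), qfree p -> (forall z, A (v z)) ->
  sat (merge v (fun z => val_of (u z))) p ->
  exists m : M -> N, sat (merge (fun z => m (v z)) u) p.

Lemma ec_refl M (N : substructure M) : ec N N.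
Proof.
move=> p v u qp Nv hp.
have /choice[m hm] : forall x, exists y : N, N x -> val_of y = x.
  move=> x; have [Nx|nx] := pselect (N x); first by exists (exist _ x Nx).
  by exists (u 0).
exists m; apply/(sat_qfree _ (val_embedding N)) => //; rewrite comp_merge.
by apply: sat_eq hp => z; rewrite /merge; case: ifP => // _; rewrite hm.
Qed.

(** The index set is [M -> N]. Each true quantifier-free formula with parameters in [A] and [N]
    defines the set [B j] of maps that keep it true. Existential closedness makes these sets
    nonempty, conjunctions make them a filter base, and an ultrafilter extends it. A point [a] goes
    to the class of the evaluation of maps at [a]. *)
Lemma ec_ultrapower M (N : substructure M) (A : set M) :
  N `<=` A -> ec N A ->
  exists (K : structure L) (e : N -> K) (h : M -> K),
    [/\ elementary_embedding e, forall x : N, h (val_of x) = e x &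
        forall p v, qfree p -> (forall z, A (v z)) -> sat v p ->
          sat (fun z => h (v z)) p].
Proof.
move=> NA ecA.
pose J := (formula L * (nat -> M) * (nat -> N))%type.
pose D : set J := [set j | [/\ qfree j.1.1, forall z, A (j.1.2 z) &
  sat (merge j.1.2 (fun z => val_of (j.2 z))) j.1.1]].
pose B (j : J) : set (M -> N) :=
  [set m | sat (merge (fun z => m (j.1.2 z)) j.2) j.1.1].
have [x0] := carrier_inhabited N.
have FF : Filter (filter_from D B).
  apply: filter_from_filter.
    exists (Imp Bot Bot, (fun=> val_of x0), (fun=> x0)).
    by split=> // z; apply/NA/svalP.
  move=> [[p v] u] [[q v'] u'] [/= qp Av hp] [/= qq Av' hq].
  (* Both pairs of parameter tuples are interleaved; [r1] and [r2] redirect the variables of [p] and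
     of [q] to their own halves. *)
  pose r1 z := merge (fun z => z.*2.*2) (fun z => z.*2.*2.+1) z.
  pose r2 z := merge (fun z => z.*2.+1.*2) (fun z => z.*2.+1.*2.+1) z.
  have e1 (E : Type) (a a' b b' : nat -> E) z :
      merge (merge a a') (merge b b') (r1 z) = merge a b z.
    rewrite /r1 {4}/merge [RHS]/merge.
    by case: ifP; rewrite ?merge_odd !merge_even.
  have e2 (E : Type) (a a' b b' : nat -> E) z :
      merge (merge a a') (merge b b') (r2 z) = merge a' b' z.
    rewrite /r2 {4}/merge [RHS]/merge.
    by case: ifP; rewrite ?merge_odd ?merge_even ?merge_odd.
  exists (And (ren r1 p) (ren r2 q), merge v v', merge u u').
    split=> /=.
    - by repeat split; apply: qfree_ren.
    - by move=> z; rewrite /merge; case: ifP.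
    - rewrite (comp_merge (@val_of L M N)); apply/sat_and; split; apply/sat_ren.
        by apply: sat_eq hp => z; rewrite e1.
      by apply: sat_eq hq => z; rewrite e2.
  move=> m; rewrite /B /= (comp_merge m) => /sat_and[/sat_ren h1 /sat_ren h2].
  split; first by apply: sat_eq h1 => z; rewrite e1.
  by apply: sat_eq h2 => z; rewrite e2.
have PF : ProperFilter (filter_from D B).
  by apply: filter_from_proper => -[[p v] u] [/= qp Av hp]; apply: ecA.
have [U [UU FU]] := ultraFilterLemma PF.
exists (ultrapower N UU), (fun x => cls UU (fun=> x)),
  (fun a => cls UU (fun m => m a)).
split; first exact: ultrapower_diag.
  move=> x; apply/cls_eq/FU.
  (* This equation makes almost every index [m] fix [x]. *)
  exists (Eq (Var 0) (Var 1), (fun=> val_of x), (fun=> x)) => //=.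
  by split=> // z; apply/NA/svalP.
move=> p v qp Av hp; apply/(los UU (fun z m => m (v z)))/FU.
exists (ren double p, v, (fun=> x0)).
  split=> //=; first exact: qfree_ren.
  by apply/sat_ren; apply: sat_eq hp => z; rewrite merge_even.
by move=> m /= /sat_ren; apply: sat_eq => z; rewrite merge_even.
Qed.

Lemma ec_bigcup M (N : substructure M) (F : set (set M)) :
  F !=set0 -> total_on F subset ->
  (forall A, F A -> N `<=` A) -> (forall A, F A -> ec N A) ->
  ec N (\bigcup_(A in F) A).
Proof.
move=> F0 Ftot NF ecF p v u qp Fv hp.
have [i|A [FA hA]] :=
    @chain_finite _ F (vbound p) (fun i => v i) F0 Ftot.
  by have [A FA Av] := Fv i; exists A.
pose v' z := if z < vbound p then v z else val_of (u 0).
have lt z : z < vbound p -> z./2 < vbound p.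
  by apply: leq_ltn_trans; rewrite leq_half_double leqW // -addnn leq_addr.
have [||m hm] := ecF A FA p v' u qp.
- move=> z; rewrite /v'; case: ltnP => [zp|_]; first exact: (hA (Ordinal zp)).
  exact/(NF _ FA)/svalP.
- apply: (proj1 (sat_eq_in _)) hp => z zp; rewrite /merge; case: ifP => // _.
  by rewrite /v' lt.
- exists m; apply: (proj1 (sat_eq_in _)) hm => z zp; rewrite /merge.
  by case: ifP => // _; rewrite /v' lt.
Qed.

Lemma closed_bigcup M (F : set (set M)) :
  F !=set0 -> total_on F subset -> (forall A, F A -> @fclosed L M A) ->
  @fclosed L M (\bigcup_(A in F) A).
Proof.
move=> F0 Ftot clF f a Fa.
have [i|A [FA hA]] := @chain_finite _ F _ a F0 Ftot.
  by have [A FA Aa] := Fa i; exists A.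
by exists A => //; apply: clF.
Qed.

Section Inclusion.
Variables (M : structure L) (A B : substructure M).
Hypothesis AB : included A B.

Definition inclusion (x : A) : B := exist _ (sval x) (AB (svalP x)).

Lemma inclusion_embedding : embedding inclusion.
Proof.
split=> [x y [/sval_inj//]|f a|//].
exact: sval_inj.
Qed.

End Inclusion.

Lemma model_eq_sub (T : theory L) M (A B : substructure M) :
  included A B -> included B A -> model T A -> model T B.
Proof.
move=> AB BA; apply: (proj1 (model_elementary T (h := inclusion AB) _)).
apply: surjective_embedding_elementary; first exact: inclusion_embedding.
by move=> y; exists (inclusion BA y); apply: sval_inj.
Qed.

(** Let [C] be a T-closure of [R]. It embeds over [R] into [M], with image [B], and into [K]. A
    quantifier-free formula over [N] realized in [B] is therefore realized in [K], then in [S] by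
    elementarity of [e], then in [N] because [N] is existentially closed in [S]. *)
Lemma ec_step (T : theory L) M K (N S R : substructure M)
    (e : S -> K) (h : R -> K) :
  D_property T -> model T M -> model T S ->
  included N S -> included S R -> ec N S ->
  elementary_embedding e -> embedding h ->
  (forall (x : S) (y : R), val_of y = val_of x -> h y = e x) ->
  exists B : substructure M, [/\ model T B, included R B & ec N B].
Proof.
move=> [Dclo _] mM mS NS SR ecS ee eh he.
have [C [c [mC ec_ univ]]] := Dclo M R mM.
have [k [ek kc]] := univ _ _ mM (val_embedding R).
have [k' [ek' k'c]] := univ _ _ (proj1 (model_elementary T ee) mS) eh.
exists (image_sub ek); split.
- exact/(model_elementary T (to_image_elementary ek)).
- by move=> x Rx; exists (c (exist _ x Rx)); rewrite kc.
move=> p v u qp /= /choice[w kw] hp.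
have /choice[y hy] : forall x, exists y, forall b, k b = x -> k' b = y.
  move=> x; have [[b kb]|nx] := pselect (exists b, k b = x).
    by exists (k' b) => b' kb'; have [ki _ _] := ek; rewrite (ki b' b) ?kb.
  by exists (k' (w 0)) => b kb; case: nx; exists b.
pose uS z : S := inclusion NS (u z).
pose uR z : R := inclusion SR (uS z).
have hC : sat (merge w (fun z => c (uR z))) p.
  apply/(sat_qfree _ ek qp); rewrite comp_merge; apply: sat_eq hp => z.
  by rewrite /merge; case: ifP; rewrite ?kc ?kw.
have /(elementary_pullback ee)[m hm] :
    sat (merge (fun z => y (v z)) (fun z => e (uS z))) p.
  have := proj1 (sat_qfree _ ek' qp) hC; rewrite comp_merge.
  apply: sat_eq => z; rewrite /merge; case: ifP => _.
    by rewrite k'c; apply: he.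
  by rewrite (hy (v z./2)).
have := proj1 (sat_qfree _ (val_embedding S) qp) hm.
rewrite comp_merge => /ecS[//|z|m' hm']; first exact: svalP.
by exists (fun x => m' (val_of (m x))).
Qed.

Lemma D_ec (T : theory L) M (N : substructure M) :
  D_property T -> model T M -> model T N -> ec N setT.
Proof.
move=> DT mM mN; have [_ D2] := DT.
pose P (A : set M) := [/\ N `<=` A, @fclosed L M A & ec N A].
have [||A [[NA clA ecA] Amax]] := @Zorn_chain M P N.
- by split=> //; [apply: smem_closed|apply: ec_refl].
- move=> F [A FA] FP Ftot; split.
  + by move=> x Nx; exists A => //; have [NA _ _] := FP _ FA; apply: NA.
  + by apply: closed_bigcup => //; [exists A|move=> B /FP[]].
  + by apply: ec_bigcup => //; [exists A|move=> B /FP[]..].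
have A0 : exists x, A x by have [x Nx] := smem_nonempty N; exists x; apply: NA.
pose SA := Substructure A0 clA.
have max (B : substructure M) : included SA B -> ec N B -> included B SA.
  move=> AB ecB; apply: Amax => //; split=> //; last exact: smem_closed.
  by move=> x /NA/AB.
have mA : model T SA.
  (* First use of the step, from [N] to [A]: the ultrapower is the elementary extension of [N] into
     which [A] embeds. By maximality the model [B] so obtained is [A] itself. *)
  have [K [e [h [ee he hq]]]] := ec_ultrapower NA ecA.
  have eh : embedding (fun x : SA => h (val_of x)).
    apply: qfree_embedding => p v qp hp; apply: (hq p (fun z => val_of (v z))) => //.
      by move=> z; apply: svalP.
    exact/(sat_qfree _ (val_embedding SA)).
  have [|||x y yx|B [mB AB ecB]] :=
      @ec_step T M K N N SA e _ DT mM mN _ _ _ ee eh.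
  - by [].
  - exact: NA.
  - exact: ec_refl.
  - by rewrite yx he.
  - by apply: model_eq_sub mB => //; apply: max.
have [pA|nA] := pselect (proper SA); last first.
  move=> p v u qp _; apply: ecA => // z.
  by apply: contrapT => nAz; apply: nA; exists (v z).
(* Second use, from [A] to [A + a]: the model [B] would properly extend the maximal [A]. *)
have [a [nAa [K [e [h [ee eh he]]]]]] := D2 M SA mM mA pA.
have [||||B [mB AB ecB]] :=
    @ec_step T M K N SA (adjoin SA a) e h DT mM mA _ _ _ ee eh.
- exact: NA.
- by move=> x Ax; apply: generated_sub; left.
- exact: ecA.
- exact: he.
- case: nAa; apply: (max B) => //; last by apply: AB; apply: generated_sub; right.
  by move=> x Ax; apply: AB; apply: generated_sub; left.
Qed.

(** Stated for embeddings so that the induction hypothesis covers [h : M -> K], where [K] is an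
    elementary extension of the image of [N]. A universal formula true in [N] is true in [K], and
    its instance at [h d] descends to [M] by the induction hypothesis. *)
Lemma D_embedding_elementary (T : theory L) M N (g : N -> M) :
  D_property T -> model T M -> model T N -> embedding g ->
  elementary_embedding g.
Proof.
move=> DT mM mN eg; split=> // p.
elim: p M N g mM mN eg => [|s t|r a|p IHp q IHq|x p IHp] M N g mM mN eg v.
- by [].
- exact: sat_qfree.
- exact: sat_qfree.
- by rewrite /= (IHp M N g) ?(IHq M N g).
have elg := to_image_elementary eg.
have mS := proj1 (model_elementary T elg) mN.
have [K [e [h [ee he hq]]]] := ec_ultrapower (@subsetT _ _) (D_ec DT mM mS).
have eh : embedding h by apply: qfree_embedding => p' v' q'; apply: hq.
have ed d := IHp K M h (proj1 (model_elementary T ee) mS) mM eh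
  (update (fun z => g (v z)) x d).
split=> [hp d|hp d]; last first.
  by apply/(IHp M N g) => //; rewrite comp_update; apply: hp.
apply/ed; rewrite comp_update.
have [_ heg] := elementary_comp elg ee.
have /(_ (h d)) := proj1 (heg (All x p) v) hp.
by apply: sat_eq => z; rewrite /update; case: ifP => // _; rewrite -he.
Qed.

Lemma D_model_complete (T : theory L) : D_property T -> model_complete T.
Proof.
move=> DT M N mM mN; apply: D_embedding_elementary DT mM mN _.
exact: val_embedding.
Qed.

Lemma embedding_inverse M N (h : M -> N) (g : N -> M) :
  embedding h -> (forall y, h (g y) = y) -> embedding g.
Proof.
move=> [hi hf hr] gK; split; first exact: can_inj gK.
  move=> f a; apply: hi; rewrite hf gK; congr (fint N f).
  by apply: funext => i; rewrite gK.
move=> r a; rewrite hr; set b := fun i => _; suff -> : b = a by [].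
by apply: funext => i; rewrite /b gK.
Qed.

Lemma image_isomorphism M1 M2 K (g1 : K -> M1) (g2 : K -> M2)
    (e1 : embedding g1) (e2 : embedding g2) :
  exists f : image_sub e1 -> image_sub e2,
    isomorphism f /\ forall x, f (to_image e1 x) = to_image e2 x.
Proof.
have /choice[r1 r1K] := to_image_surj (eg := e1).
have /choice[r2 r2K] := to_image_surj (eg := e2).
have [i1 _ _] := to_image_embedding e1; have [i2 _ _] := to_image_embedding e2.
have ti1 x : r1 (to_image e1 x) = x by apply: i1.
have ti2 x : r2 (to_image e2 x) = x by apply: i2.
exists (fun y => to_image e2 (r1 y)); split; last by move=> x; rewrite ti1.
split.
  have er1 := embedding_inverse (to_image_embedding e1) r1K.
  exact: embedding_comp er1 (to_image_embedding e2).
by exists (fun y => to_image e1 (r2 y)) => y; rewrite ?ti1 ?ti2 ?r1K ?r2K.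
Qed.

(** One T-closure of [N1] embeds into [M1] over the inclusion of [N1] and into [M2] over [f]; its
    two images carry the extended isomorphism. *)
Lemma D_SS (T : theory L) : D_property T -> SS_property T.
Proof.
move=> DT; split; last exact: D_model_complete.
move=> M1 M2 N1 N2 f m1 m2 [ef bf].
have [C [c [mC _ univ]]] := DT.1 M1 N1 m1.
have [k1 [ek1 k1c]] := univ _ _ m1 (val_embedding N1).
have [k2 [ek2 k2c]] := univ _ _ m2 (embedding_comp ef (val_embedding N2)).
have [f' [if' f'E]] := image_isomorphism ek1 ek2.
exists (image_sub ek1), (image_sub ek2), f'; split=> //.
- split=> [x Nx|x Nx].
    by exists (c (exist _ x Nx)); rewrite k1c.
  have [g _ fg] := bf; exists (c (g (exist _ x Nx))); rewrite k2c.
  by rewrite fg.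
- by split; [apply/(model_elementary T (to_image_elementary ek1))
            |apply/(model_elementary T (to_image_elementary ek2))].
- move=> x x' xx; rewrite -[x'](_ : to_image ek1 (c x) = x').
    by rewrite f'E /= k2c.
  by apply: sval_inj; rewrite /= k1c -xx.
Qed.

End ModelCompleteness.

(** * The SS-property: models sharing submodels *)

Section SubmodelSharing.
Variable L : language.
Implicit Types M N K : structure L.

Lemma model_complete_embedding (T : theory L) M N (g : N -> M) :
  model_complete T -> model T M -> model T N -> embedding g ->
  elementary_embedding g.
Proof.
move=> mc mM mN eg; have eti := to_image_elementary eg.
exact: elementary_comp eti (mc _ _ mM (proj1 (model_elementary T eti) mN)).
Qed.

(** The isomorphism between the two images of [N] extends to submodels by (i); [K] is its domain,
    mapped to [M1] by inclusion and to [M2] through the isomorphism. Model completeness makes both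
    maps elementary. *)
Lemma SS_common_submodel (T : theory L) N M1 M2 (g1 : N -> M1) (g2 : N -> M2) :
  SS_property T -> model T M1 -> model T M2 -> embedding g1 -> embedding g2 ->
  exists K (e : N -> K) (k1 : K -> M1) (k2 : K -> M2),
    [/\ model T K, elementary_embedding k1, elementary_embedding k2,
        forall x, k1 (e x) = g1 x & forall x, k2 (e x) = g2 x].
Proof.
move=> [ss mc] m1 m2 e1 e2.
have [f [isof fE]] := image_isomorphism e1 e2.
have [K1 [K2 [f' [[N1K N2K] [mK1 mK2] [ef' _] f'E]]]] := ss _ _ _ _ f m1 m2 isof.
exists K1, (fun x => inclusion N1K (to_image e1 x)), (@val_of L M1 K1),
  (fun x => val_of (f' x)); split=> //.
- exact: mc.
- apply: model_complete_embedding mc m2 mK1 _.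
  exact: embedding_comp ef' (val_embedding K2).
- by move=> x; rewrite (f'E (to_image e1 x)) // fE.
Qed.

Lemma SS_same_type (T : theory L) N M1 M2 (g1 : N -> M1) (g2 : N -> M2) p
    (v : nat -> N) :
  SS_property T -> model T M1 -> model T M2 -> embedding g1 -> embedding g2 ->
  sat (fun z => g1 (v z)) p <-> sat (fun z => g2 (v z)) p.
Proof.
move=> ss m1 m2 e1 e2.
have [K [e [k1 [k2 [mK [_ h1] [_ h2] k1e k2e]]]]] :=
  SS_common_submodel ss m1 m2 e1 e2.
have -> : (fun z => g1 (v z)) = (fun z => k1 (e (v z))).
  by apply: funext => z; rewrite k1e.
have -> : (fun z => g2 (v z)) = (fun z => k2 (e (v z))).
  by apply: funext => z; rewrite k2e.
by rewrite -h1 -h2.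
Qed.

End SubmodelSharing.

(** * Countability of formulas and countable closures *)

Section Countability.

Lemma countable_formula (L : language) :
  countable_language L -> exists c : formula L -> nat, injective c.
Proof.
move=> [[cf cfI] [cr crI]].
pose tcode := fix tcode (t : term L) : GenTree.tree nat :=
  match t with
  | Var x => GenTree.Leaf x
  | App f a => GenTree.Node (cf f) [seq tcode (a i) | i <- enum 'I_(farity f)]
  end.
pose fcode := fix fcode (p : formula L) : GenTree.tree nat :=
  match p with
  | Bot => GenTree.Node 0 [::]
  | Eq s t => GenTree.Node 1 [:: tcode s; tcode t]
  | Rel r a => GenTree.Node 2 (GenTree.Leaf (cr r) ::
                 [seq tcode (a i) | i <- enum 'I_(rarity r)])
  | Imp p q => GenTree.Node 3 [:: fcode p; fcode q]
  | All x p => GenTree.Node 4 [:: GenTree.Leaf x; fcode p]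
  end.
have tI : injective tcode.
  elim=> [x|f a IH] [y|g b] //=; first by move=> [->].
  move=> [/cfI e]; case: _ / e in b * => /eq_in_map ab.
  by congr App; apply: funext => i; apply/IH/ab; rewrite mem_enum.
have fI : injective fcode.
  elim=> [|s t|r a|p IHp q IHq|x p IHp] [|s' t'|r' a'|p' q'|x' p'] //=.
  - by move=> [/tI -> /tI ->].
  - move=> [/crI e]; case: _ / e in a' * => /eq_in_map ab.
    by congr Rel; apply: funext => i; apply/tI/ab; rewrite mem_enum.
  - by move=> [/IHp -> /IHq ->].
  - by move=> [-> /IHp ->].
by exists (fun p => pickle (fcode p)) => p q /(pcan_inj pickleK)/fI.
Qed.

(** [E k] enumerates elements reached in at most [k] rounds of applying the operations. In a code,
    [None] repeats an element of the previous stage, so the stages increase and every finite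
    sequence lies in one of them. *)
Lemma countable_closure (I X : Type) (G : I -> seq X -> X) (A : set X) :
  (exists c : I -> nat, injective c) -> A !=set0 ->
  (forall i (f : nat -> X) s, (forall n, A (f n)) -> A (G i [seq f n | n <- s])) ->
  exists e : nat -> X, (forall n, A (e n)) /\
    forall i (s : seq nat), exists n, e n = G i [seq e z | z <- s].
Proof.
move=> [c cI] [x0 Ax0] GA.
have /choice[dec decE] : forall n, exists o, forall i, c i = n -> o = Some i.
  move=> n; have [[i ci]|ni] := pselect (exists i, c i = n).
    by exists (Some i) => j cj; congr Some; apply: cI; rewrite ci.
  by exists None => i ci; case: ni; exists i.
pose step (f : nat -> X) m := match unpickle m : option (option nat * seq nat) with
  | Some (Some j, s) => if dec j is Some i then G i [seq f n | n <- s] else x0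
  | Some (None, s) => head x0 [seq f n | n <- s]
  | None => x0
  end.
pose E k := iter k step (fun=> x0).
have stepA f : (forall n, A (f n)) -> forall n, A (step f n).
  move=> Af n; rewrite /step; case: unpickle => // -[[j|] s].
    by case: (dec j) => // i; apply: GA.
  by case: s => [|m s] /=.
have EA k n : A (E k n) by elim: k n => //= k IH n; apply: stepA.
have Emono k k' m : k <= k' -> exists m', E k' m' = E k m.
  move=> /subnKC <-; elim: (k' - k) => [|j [m' <-]]; first by exists m; rewrite addn0.
  by rewrite addnS; exists (pickle (@None nat, [:: m'])); rewrite /= /step pickleK.
have Emono_seq k k' s : k <= k' ->
    exists s', [seq E k' m | m <- s'] = [seq E k m | m <- s].
  move=> kk'; elim: s => [|m s [s' IH]]; first by exists [::].
  by have [m' em] := Emono k k' m kk'; exists (m' :: s'); rewrite /= em IH.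
pose e n := if (unpickle n : option (nat * nat)) is Some (k, m) then E k m else x0.
have eA n : A (e n) by rewrite /e; case: unpickle => // -[].
exists e; split=> // i s.
have [k [s' ss']] : exists k s', [seq e z | z <- s] = [seq E k m | m <- s'].
  elim: s => [|z s [k [s' IH]]]; first by exists 0, [::].
  have [k1 [m1 ez]] : exists k1 m1, e z = E k1 m1.
    by rewrite /e; case: unpickle => [[k1 m1]|]; [exists k1, m1|exists 0, 0].
  have [m2 em2] := Emono _ _ m1 (leq_maxr k k1).
  have [s2 es2] := Emono_seq _ _ s' (leq_maxl k k1).
  by exists (maxn k k1), (m2 :: s2); rewrite /= em2 es2 ez IH.
exists (pickle (k.+1, pickle (Some (c i), s'))); rewrite /e pickleK ss'.
by rewrite /= /step pickleK (decE _ i).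
Qed.

End Countability.

(** * Generic pairs of models over a countable substructure *)

(* No formula consistent with [p] isolates a complete type over [N]. *)
Definition splitting (L : language) (M : structure L) (N : set M) p
    (b : nat -> M) :=
  forall r (v : nat -> M), (forall z, N (v z)) ->
  (exists d, sat (scons d v) r /\ sat (scons d b) p) ->
  exists d d' q (u : nat -> M), (forall z, N (u z)) /\
    [/\ sat (scons d v) r /\ sat (scons d b) p,
        sat (scons d' v) r /\ sat (scons d' b) p,
        sat (scons d u) q & ~ sat (scons d' u) q].

Section Generic.
Variables (L : language) (M : structure L) (N : substructure M) (e : nat -> M).
Hypotheses (Ne : forall n, N (e n)) (eN : forall x, N x -> exists n, e n = x).
Implicit Types (p q r : formula L) (c : nat -> M).

(* A condition is a formula in which the even variables name the elements of
   [N], as enumerated by [e], and the odd ones are the generic elements. *)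
Definition consistent q := exists c, sat (merge e c) q.
Definition extends q' q := forall c, sat (merge e c) q' -> sat (merge e c) q.
Definition henkin r q := exists k, forall c d, sat (merge e c) q ->
  sat (scons d (merge e c)) r -> sat (scons (c k) (merge e c)) r.

(** If [q] excludes every witness of [r], then [q] itself works. Otherwise a witness is named by a
    generic variable beyond all variables of [q] and [r]. *)
Lemma henkin_dense r q : consistent q ->
  exists q', [/\ consistent q', extends q' q & henkin r q'].
Proof.
move=> cq; have [[c [d [hq hr]]]|n] := pselect (exists c d,
    sat (merge e c) q /\ sat (scons d (merge e c)) r); last first.
  by exists q; split=> //; exists 0 => c d hq hr; case: n; exists c, d.
pose k := maxn (vbound q) (vbound r).
have ek z : z < k -> merge e (update c k d) z = merge e c z.
  move=> zk; rewrite /merge /update; case: ifP => // _; case: eqP => // zk2.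
  suff : k <= z by rewrite leqNgt zk.
  by rewrite -zk2 leq_half_double leqW // -addnn leq_addr.
exists (And q (ren0 k.*2.+1 id r)); split.
- exists (update c k d); apply/sat_and; split.
    by apply: (proj2 (sat_eq_in _)) hq => z zq; rewrite ek // leq_max zq.
  apply/sat_ren0; rewrite merge_odd /update eqxx.
  apply: (proj2 (sat_eq_in _)) hr => -[//|z] zr /=; rewrite ek //.
  by rewrite leq_max (ltnW zr) orbT.
- by move=> c' /sat_and[].
- by exists k => c' d' /sat_and[_ /sat_ren0]; rewrite merge_odd.
Qed.

Lemma param_formula k r (u : nat -> M) : (forall z, N (u z)) ->
  exists q, forall c, sat (merge e c) q <-> sat (scons (c k) u) r.
Proof.
move=> Nu; have /choice[ku kuE] : forall z, exists n, e n = u z.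
  by move=> z; apply: eN.
exists (ren0 k.*2.+1 (fun z => (ku z).*2) r) => c; rewrite sat_ren0 merge_odd.
suff -> : (fun z => merge e c (ku z).*2) = u by [].
by apply: funext => z; rewrite merge_even kuE.
Qed.

(** The values that the k-th generic element may take under [q] are definable over [N]: all the
    other generic variables are quantified away. *)
Lemma projection_formula k q : exists r (v : nat -> M), (forall z, N (v z)) /\
  forall d, sat (scons d v) r <-> exists c, c k = d /\ sat (merge e c) q.
Proof.
pose Q z := odd z && (z != k.*2.+1).
exists (focus k.*2.+1 (exs Q q)), (merge e (fun=> e 0)); split.
  by move=> z; rewrite /merge; case: ifP.
move=> d; rewrite sat_focus sat_exs; split=> [[w [ew hw]]|[c [ck hc]]].
  exists (fun z => w z.*2.+1); split.
    by rewrite ew /Q ?eqxx ?andbF // /update eqxx.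
  apply: sat_eq hw => z; rewrite /merge; case: ifP => oz.
    by rewrite -[in LHS](odd_double_half z) oz.
  rewrite ew /Q ?oz // /update; case: eqP => [zk|_]; last by rewrite /merge oz.
  by rewrite zk /= odd_double in oz.
exists (merge e c); split=> // z; rewrite /Q negb_and negbK /update.
case: eqP => [->|_]; first by rewrite merge_odd.
by rewrite orbF /merge => /negPf ->.
Qed.

Section Separation.
Variables (p : formula L) (b : nat -> M).
Hypothesis Nb : forall z, N (b z).
Hypothesis split_p : splitting N p b.

(** Ensures that the i-th generic element of the first model does not both realize [p] and have the
    type over [N] of the j-th generic element of the second. *)
Definition separated i j q1 q2 :=
  (forall c, sat (merge e c) q1 -> ~ sat (scons (c i) b) p) \/
  exists q (u : nat -> M), [/\ forall z, N (u z),
    forall c, sat (merge e c) q1 -> sat (scons (c i) u) q &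
    forall c, sat (merge e c) q2 -> ~ sat (scons (c j) u) q].

(** Unless [q1] excludes [p] at [c i], the values of [c i] compatible with [q1] and [p] are
    definable over [N], hence split by some [q]. Of [q] and its negation, the one that fails at
    [c2 j] is imposed on the first side and its negation on the second. *)
Lemma separated_dense i j q1 q2 : consistent q1 -> consistent q2 ->
  exists q1' q2', [/\ consistent q1', consistent q2', extends q1' q1,
    extends q2' q2 & separated i j q1' q2'].
Proof.
move=> cq1 [c2 hc2].
have [p' p'E] := param_formula i p Nb.
have [[c0 hc0]|n] := pselect (consistent (And q1 p')); last first.
  exists q1, q2; split=> //; first by exists c2.
  left=> c hc hp; apply: n; exists c; apply/sat_and; split=> //.
  exact/p'E.
have [r [v [Nv rE]]] := projection_formula i (And q1 p').
have [|d [d' [q [u [Nu [[rd _] [rd' _] qd qd']]]]]] := @split_p r v Nv.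
  exists (c0 i); split; first by apply/rE; exists c0.
  by have /sat_and[_ /p'E] := hc0.
have [s [c1 [hc1 sc1 sc2]]] : exists s c1,
    [/\ sat (merge e c1) q1, sat (scons (c1 i) u) s & ~ sat (scons (c2 j) u) s].
  have [hj|hj] := pselect (sat (scons (c2 j) u) q).
    move/rE: rd' => [c1 [ci /sat_and[hc1 _]]]; exists (Not q), c1; split=> //.
      by rewrite ci.
    by apply.
  by move/rE: rd => [c1 [ci /sat_and[hc1 _]]]; exists q, c1; split=> //; rewrite ci.
have [s1 s1E] := param_formula i s Nu.
have [s2 s2E] := param_formula j (Not s) Nu.
exists (And q1 s1), (And q2 s2); split.
- by exists c1; apply/sat_and; split=> //; apply/s1E.
- by exists c2; apply/sat_and; split=> //; apply/s2E.
- by move=> c /sat_and[].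
- by move=> c /sat_and[].
- right; exists s, u; split=> // c /sat_and[_]; first by move/s1E.
  by move/s2E.
Qed.

(** Stage [n] meets, on both sides, the Henkin requirement of the formula with code [n], and
    separates the pair with code [n]. *)
Lemma generic_pair (C : countable_language L) :
  exists q1 q2 : nat -> formula L,
    [/\ forall n, consistent (q1 n) /\ consistent (q2 n),
        forall n, extends (q1 n.+1) (q1 n) /\ extends (q2 n.+1) (q2 n),
        forall r, exists n, henkin r (q1 n),
        forall r, exists n, henkin r (q2 n) &
        forall i j, exists n, separated i j (q1 n) (q2 n)].
Proof.
have [cf cfI] := countable_formula C.
pose good (s : formula L * formula L) := consistent s.1 /\ consistent s.2.
pose ext (s' s : formula L * formula L) := extends s'.1 s.1 /\ extends s'.2 s.2.
pose meets n (s : formula L * formula L) := [/\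
  forall r, cf r = n -> henkin r s.1, forall r, cf r = n -> henkin r s.2 &
  forall i j, pickle (i, j) = n -> separated i j s.1 s.2].
have hk n q : consistent q -> exists q',
    [/\ consistent q', extends q' q & forall r, cf r = n -> henkin r q'].
  move=> cq; have [[r cr]|nr] := pselect (exists r, cf r = n).
    have [q' [cq' eq' hq']] := henkin_dense r cq; exists q'; split=> // r' cr'.
    by rewrite (cfI r' r) // cr.
  by exists q; split=> // r cr; case: nr; exists r.
have hkS r q q' : extends q' q -> henkin r q -> henkin r q'.
  by move=> ex [k hk']; exists k => c d /ex; apply: hk'.
have /choice[F hF] : forall ns : nat * (formula L * formula L), exists s',
    good ns.2 -> [/\ good s', ext s' ns.2 & meets ns.1 s'].
  move=> [n s]; have [gs|ngs] := pselect (good s); last by exists s.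
  have [a1 [c1 e1 h1]] := hk n _ gs.1; have [a2 [c2 e2 h2]] := hk n _ gs.2.
  pose ij := odflt (0, 0) (unpickle n : option (nat * nat)).
  have [b1 [b2 [d1 d2 f1 f2 sep]]] := separated_dense ij.1 ij.2 c1 c2.
  exists (b1, b2) => _ /=; split=> //.
    by split=> c /=; [move/f1/e1|move/f2/e2].
  split=> [r /h1|r /h2|i j ijn].
  - exact: hkS.
  - exact: hkS.
  - by move: sep; rewrite /ij -ijn pickleK.
pose S := fix S n := if n is n'.+1 then F (n', S n')
  else (Imp Bot Bot, Imp Bot Bot) : formula L * formula L.
have gS n : good (S n).
  elim: n => [|n IH]; first by split; exists e.
  by have [] := hF (n, S n) IH.
have mS n : meets n (S n.+1) by have [] := hF (n, S n) (gS n).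
exists (fun n => (S n).1), (fun n => (S n).2); split.
- exact: gS.
- by move=> n; have [] := hF (n, S n) (gS n).
- by move=> r; exists (cf r).+1; have [h _ _] := mS (cf r); apply: h.
- by move=> r; exists (cf r).+1; have [_ h _] := mS (cf r); apply: h.
- move=> i j; exists (pickle (i, j)).+1; have [_ _ h] := mS (pickle (i, j)).
  exact: h.
Qed.

End Separation.

(** Instead of a term model, realizations [cn n] of the conditions [q n] are chosen in [M]. In an
    ultrapower over an ultrafilter containing the final segments of [nat], the class of the sequence
    [cn m k] in [m] is the k-th generic element. Every condition holds almost everywhere, and the
    Henkin requirements make the generic elements an elementary submodel. *)
Lemma generic_model (T : theory L) (q : nat -> formula L) :
  model T M -> (forall n, consistent (q n)) ->
  (forall n, extends (q n.+1) (q n)) -> (forall r, exists n, henkin r (q n)) ->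
  exists (K : structure L) (h : N -> K), [/\ model T K, embedding h,
    forall r (v : nat -> N),
      sat (fun z => val_of (v z)) r <-> sat (fun z => h (v z)) r &
    forall x : K, exists k, forall r (u : nat -> N) n,
      (forall c, sat (merge e c) (q n) ->
         sat (scons (c k) (fun z => val_of (u z))) r) ->
      sat (scons x (fun z => h (u z))) r].
Proof.
move=> mM cq ext hk.
have extm n m : n <= m -> extends (q m) (q n).
  move=> /subnKC <-; elim: (m - n) => [|j IH]; first by rewrite addn0.
  by rewrite addnS => c /ext/IH.
have /choice[cn hcn] : forall n, exists c, sat (merge e c) (q n) by [].
have [U [UU FU]] := ultraFilterLemma eventually_filter.
have Uq n : U [set m | sat (merge e (cn m)) (q n)].
  by apply: FU; exists n => // m nm; apply: extm (hcn m).
pose MU := ultrapower M UU.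
pose dg x : MU := cls UU (fun=> x).
have [ed hd] : elementary_embedding dg := ultrapower_diag M UU.
pose g k : MU := cls UU (fun m => cn m k).
pose A : set MU := [set x | exists k, x = g k].
have tvA : tv_closed A.
  move=> p v /choice[kv vE] [d].
  have {vE} -> : v = (fun z => cls UU (fun m => cn m (kv z))) by apply: funext.
  have losS f : @sat L MU (scons (cls UU f)
      (fun z => cls UU (fun m => cn m (kv z)))) p <->
      U [set m | sat (scons (f m) (fun z => cn m (kv z))) p].
    rewrite -(comp_scons (@cls _ _ _ _ UU) f (fun z m => cn m (kv z))).
    rewrite (los UU (scons f (fun z m => cn m (kv z)))).
    suff -> : [set i | sat (fun z => scons f (fun z m => cn m (kv z)) z i) p] =
      [set m | sat (scons (f m) (fun z => cn m (kv z))) p] by [].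
    by rewrite predeqE => i /=; rewrite (comp_scons (fun h : nat -> M => h i)).
  move: (clsK d) => <- /losS hd'.
  (* The generic element [kv z] has code [(kv z).*2.+1]; one more step makes room for the witness at
     0. *)
  have [n [k hn]] := hk (ren0 0 (fun z => (kv z).*2.+2) p).
  exists (g k); split; first by exists k.
  apply/losS; apply: filterS2 (Uq n) hd' => m hm hp.
  have e2 y : (fun z => scons y (merge e (cn m)) (kv z).*2.+2) =
      (fun z => cn m (kv z)) by apply: funext => z /=; rewrite merge_odd.
  have hr : sat (scons (sval d m) (merge e (cn m)))
      (ren0 0 (fun z => (kv z).*2.+2) p) by apply/sat_ren0; rewrite e2.
  by have /sat_ren0 := hn _ _ hm hr; rewrite e2.
have A0 : A (g 0) by exists 0.
pose S := Substructure (ex_intro _ _ A0) (tv_closed_fclosed A0 tvA).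
have eS : elementary_embedding (@val_of L MU S) by apply: tarski_vaught.
have [evS hS] := eS.
have dgA x : N x -> A (dg x).
  (* The Henkin requirement for the equation with [e n] makes each element of [N] a generic
     element. *)
  move=> /eN[n <-]; have [n0 [k hn]] := hk (Eq (Var 0) (Var n.*2.+1)).
  exists k; apply/cls_eq; apply: filterS (Uq n0) => m hm.
  have /= := hn _ (e n) hm; rewrite merge_even => /(_ erefl) <-.
  by [].
pose h (x : N) : S := exist _ (dg (val_of x)) (dgA _ (svalP x)).
have hE r v : sat (fun z => val_of (v z)) r <-> sat (fun z => h (v z)) r.
  by rewrite hd hS.
exists S, h; split=> //.
- by apply/(model_elementary T eS)/(model_elementary T (ultrapower_diag M UU)).
- apply: qfree_embedding => r v qr hr; apply/hE.
  exact: (proj1 (sat_qfree _ (val_embedding N) qr)).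
- move=> x; have [k xk] := svalP x; exists k => r u n hn.
  apply/hS; rewrite comp_scons /val_of /= xk.
  rewrite -(comp_scons (@cls _ _ _ _ UU) (fun m => cn m k)
    (fun z _ => val_of (u z))).
  apply/(los UU (scons (fun m => cn m k) (fun z _ => val_of (u z)))).
  apply: filterS (Uq n) => m /hn /=.
  by rewrite (comp_scons (fun h : nat -> M => h m)).
Qed.

(** The generic models agree with [M] on formulas over [N], so their common submodel [K] contains a
    realization of [p]. It is named by [i] in one model and by [j] in the other, with the same type
    over [N] in both, against [separated i j]. *)
Lemma countable_not_splitting (T : theory L) p (b : nat -> M) d :
  countable_language L -> SS_property T -> model T M ->
  (forall z, N (b z)) -> sat (scons d b) p ->
  ~ splitting N p b.
Proof.
move=> C ss mM Nb hd split_p.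
have [q1 [q2 [cq ext hk1 hk2 sep]]] := generic_pair Nb split_p C.
have [K1 [h1 [m1 e1 t1 x1]]] :=
  generic_model mM (fun n => (cq n).1) (fun n => (ext n).1) hk1.
have [K2 [h2 [m2 e2 t2 x2]]] :=
  generic_model mM (fun n => (cq n).2) (fun n => (ext n).2) hk2.
have [K [k [k1 [k2 [mK [_ s1] [_ s2] kE1 kE2]]]]] :=
  SS_common_submodel ss m1 m2 e1 e2.
have sK1 a r (u : nat -> N) : sat (scons a (fun z => k (u z))) r <->
    sat (scons (k1 a) (fun z => h1 (u z))) r.
  by rewrite s1 comp_scons (funext (fun z => kE1 (u z))).
have sK2 a r (u : nat -> N) : sat (scons a (fun z => k (u z))) r <->
    sat (scons (k2 a) (fun z => h2 (u z))) r.
  by rewrite s2 comp_scons (funext (fun z => kE2 (u z))).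
have lift (u : nat -> M) : (forall z, N (u z)) ->
    exists u' : nat -> N, u = (fun z => val_of (u' z)).
  by move=> Nu; exists (fun z => exist _ (u z) (Nu z)).
have [b' bE] := lift _ Nb.
have [a ha] : exists a, sat (scons a (fun z => k (b' z))) p.
  have : sat b (ex0 p) by apply/sat_ex0; exists d.
  rewrite bE t1 -(funext (fun z => kE1 (b' z))) -(s1 (ex0 p) (fun z => k (b' z))).
  by move/sat_ex0.
have [i hi] := x1 (k1 a); have [j hj] := x2 (k2 a).
have [n [np|[r [u [Nu h1u h2u]]]]] := sep i j.
  have /sK1 : sat (scons (k1 a) (fun z => h1 (b' z))) (Not p).
    by apply: (hi (Not p) b' n) => c /np; rewrite bE.
  exact.
have [u' uE] := lift _ Nu.
have /sK1 ra : sat (scons (k1 a) (fun z => h1 (u' z))) r.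
  by apply: (hi r u' n) => c /h1u; rewrite uE.
have /sK2 : sat (scons (k2 a) (fun z => h2 (u' z))) (Not r).
  by apply: (hj (Not r) u' n) => c /h2u; rewrite uE.
exact.
Qed.

End Generic.

(** * Density of isolated elements and T-closures *)

Section Isolation.
Variable L : language.
Implicit Types M N K : structure L.

Definition isolates M (A : set M) p (b : nat -> M) :=
  (forall z, A (b z)) /\
  forall d d' q (c : nat -> M), (forall z, A (c z)) ->
    sat (scons d b) p -> sat (scons d' b) p ->
    sat (scons d c) q -> sat (scons d' c) q.

Definition isolated M (A : set M) d :=
  exists p b, isolates A p b /\ sat (scons d b) p.

(* A counterexample over [N] reflects to a countable substructure, since every
   splitting involves finitely many parameters. *)
Lemma isolated_dense (T : theory L) M (N : substructure M) p (b : nat -> M) d0 :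
  countable_language L -> SS_property T -> model T M ->
  (forall z, N (b z)) -> sat (scons d0 b) p ->
  exists d, isolated N d /\ sat (scons d b) p.
Proof.
move=> C ss mM Nb hd0; apply: contrapT => nI.
have split_p r (v : nat -> M) : exists u : nat -> M, (forall z, N (u z)) /\
    ((forall z, N (v z)) -> (exists d, sat (scons d v) r /\ sat (scons d b) p) ->
    exists d d' q,
    [/\ sat (scons d v) r /\ sat (scons d b) p,
        sat (scons d' v) r /\ sat (scons d' b) p,
        sat (scons d u) q & ~ sat (scons d' u) q]).
  apply: contrapT => nu.
  have [[Nv [d [hr hp]]]|nd] := pselect ((forall z, N (v z)) /\
      exists d, sat (scons d v) r /\ sat (scons d b) p); last first.
    by apply: nu; exists b; split=> // Nv hd; case: nd.
  apply: nI; exists d; split=> //.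
  pose q := And (ren0 0 (fun z => z.*2.+1) r) (ren0 0 (fun z => z.*2.+2) p).
  have qE y : sat (scons y (merge v b)) q <->
      sat (scons y v) r /\ sat (scons y b) p.
    rewrite sat_and !sat_ren0 /=.
    rewrite (funext (merge_even v b) : (fun z => merge v b z.*2) = v).
    by rewrite (funext (merge_odd v b) : (fun z => merge v b z.*2.+1) = b).
  exists q, (merge v b); split; last exact/qE.
  split=> [z|y y' s c Nc /qE hy /qE hy' sy]; first by rewrite /merge; case: ifP.
  apply: contrapT => nsy; apply: nu; exists c; split=> // _ _.
  by exists y, y', s.
have [m0 Nm0] := smem_nonempty N.
have /choice[w hw] : forall rs : formula L * seq M, exists u : nat -> M,
    (forall z, N (u z)) /\ ((forall z, N (nth m0 rs.2 z)) ->
    (exists d, sat (scons d (nth m0 rs.2)) rs.1 /\ sat (scons d b) p) ->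
    exists d d' q,
    [/\ sat (scons d (nth m0 rs.2)) rs.1 /\ sat (scons d b) p,
        sat (scons d' (nth m0 rs.2)) rs.1 /\ sat (scons d' b) p,
        sat (scons d u) q & ~ sat (scons d' u) q]).
  by move=> [r s]; apply: split_p.
(* The countable substructure has to contain the parameters [b], be closed under the function
   symbols and contain, for each formula [r] with parameters [s], the parameters of a formula that
   splits it. *)
pose I := (nat + (fsym L + formula L * nat))%type.
pose G (i : I) (s : seq M) : M := match i with
  | inl n => b n
  | inr (inl f) => fint M f (fun j => nth m0 s j)
  | inr (inr (r, k)) => w (r, s) k
  end.
have cI : exists c : I -> nat, injective c.
  have [cf cfI] := countable_formula C; have [[cg cgI] _] := C.
  exists (fun i => pickle (match i with
    | inl n => inl n
    | inr (inl f) => inr (inl (cg f))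
    | inr (inr (r, k)) => inr (inr (cf r, k))
    end : nat + (nat + nat * nat))).
  move=> [n|[f|[r k]]] [n'|[f'|[r' k']]] /(pcan_inj pickleK) //.
  - by move=> [->].
  - by move=> [/cgI ->].
  - by move=> [/cfI -> ->].
have Nnth (f : nat -> M) s : (forall n, N (f n)) ->
    forall z, N (nth m0 [seq f n | n <- s] z).
  by move=> Nf; elim: s => [|n s IH] [|z] //=.
have [|i f s Nf|e [Ne eG]] := @countable_closure I M G N cI.
- by exists m0.
- case: i => [n|[g|[r k]]] /=; [exact: Nb| |exact: (hw _).1].
  by apply: smem_closed => i; apply: Nnth.
pose A x := exists n, e n = x.
have clA : fclosed A.
  move=> f a /choice[k hk]; have [d] := carrier_inhabited M.
  have [n en] := eG (inr (inl f)) [seq k i | i <- enum 'I_(farity f)].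
  exists n; rewrite en /= -map_comp; congr (fint M f); apply: funext => i /=.
  by rewrite (nth_map i) ?size_enum_ord // nth_ord_enum /= hk.
pose S := Substructure (ex_intro A (e 0) (ex_intro _ 0 erefl)) clA.
have Se n : S (e n) by exists n.
have Sb z : S (b z) by have [n en] := eG (inl z) [::]; exists n.
have Ssurj x : S x -> exists n, e n = x by [].
apply: (@countable_not_splitting _ _ S e Se Ssurj T p b d0) => // r v Sv.
have /choice[kv hkv] : forall z, exists n, e n = v z by [].
pose s := mkseq kv (vbound r).
have vE y : sat (scons y (nth m0 [seq e n | n <- s])) r <-> sat (scons y v) r.
  apply: sat_eq_in => -[//|z] /ltnW zr /=.
  by rewrite (nth_map 0) ?size_mkseq // nth_mkseq // hkv.
move=> [d [hdr hdp]].
have [Nw hw'] := hw (r, [seq e n | n <- s]).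
have [||y [y' [q [[yr yp] [yr' yp'] h h']]]] := hw'.
- exact: Nnth.
- by exists d; split=> //; apply/vE.
exists y, y', q, (w (r, [seq e n | n <- s])); split.
  by move=> z; have [n en] := eG (inr (inr (r, z))) s; exists n.
by split=> //; split=> //; apply/vE.
Qed.

Lemma isolated_value M (A : set M) f (a : 'I_(farity f) -> M) d :
  A d -> (forall i, A (a i)) -> isolated A (fint M f a).
Proof.
move=> Ad Aa; exists (graph_formula f), (pad d a); split; last exact/sat_graph.
split; first exact: pad_in.
by move=> y y' q c _ /sat_graph -> /sat_graph ->.
Qed.

(** A partial elementary map, given by its graph so that chains have plain unions; that it is
    single-valued follows by testing an equation. *)
Definition elementary_relation M K (R : set (M * K)) :=
  forall q v v', (forall z, R (v z, v' z)) -> sat v q -> sat v' q.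

Definition domain (X Y : Type) (R : set (X * Y)) : set X :=
  [set x | exists y, R (x, y)].

Lemma elementary_relation_functional M K (R : set (M * K)) x y y' :
  elementary_relation R -> R (x, y) -> R (x, y') -> y = y'.
Proof.
move=> eR Rxy Rxy'.
by apply: (eR (Eq (Var 0) (Var 1)) (fun=> x) (scons y (fun=> y'))) => // -[].
Qed.

(** Any realization [a'] in [K] of the transported isolating formula will do: if [q] holds of [a],
    then by isolation no realization of [p] in [M] fails [q], and this statement over the domain
    transfers to [K]. *)
Lemma elementary_relation_extend M K (R : set (M * K)) a :
  elementary_relation R -> isolated (domain R) a ->
  exists a', elementary_relation (R `|` [set (a, a')]).
Proof.
move=> eR [p [b [[/choice[b' Rb] iso] hp]]].
have : sat b (ex0 p) by apply/sat_ex0; exists a.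
move/(eR _ _ _ Rb)/sat_ex0 => [a' hp']; exists a' => q v v' Rv hq.
(* Variables with value [(a, a')] are sent to 0 and the others shifted; [(b 0, b' 0)] fills the
   vacant places so that all pairs lie in [R]. *)
have /choice[x hx] : forall z, exists x : (M * K) * nat, R x.1 /\
    (x.1 = (v z, v' z) /\ x.2 = z.+1 \/ (v z, v' z) = (a, a') /\ x.2 = 0).
  move=> z; have [Rz|->] := Rv z; last first.
    by exists ((b 0, b' 0), 0); split; [apply: Rb|right].
  by exists ((v z, v' z), z.+1); split; [|left].
pose c z := (x z).1.1; pose c' z := (x z).1.2; pose r z := (x z).2.
have Rc z : R (c z, c' z) by rewrite -surjective_pairing; apply: (hx z).1.
have vE z : scons a c (r z) = v z.
  by rewrite /r; have [_ [[xz ->]|[[-> _] ->]]] := hx z; rewrite //= /c xz.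
have vE' z : scons a' c' (r z) = v' z.
  by rewrite /r; have [_ [[xz ->]|[[_ ->] ->]]] := hx z; rewrite //= /c' xz.
have hqc : sat (scons a c) (ren r q).
  by apply/sat_ren; apply: sat_eq hq => z; rewrite vE.
pose n := ex0 (And (ren0 0 (fun z => z.*2.+1) p)
                   (Not (ren0 0 (fun z => z.*2.+2) (ren r q)))).
have nE (X : structure L) (u w : nat -> X) : sat (merge u w) n <->
    exists y, sat (scons y u) p /\ ~ sat (scons y w) (ren r q).
  have h y : sat (scons y (merge u w)) (And (ren0 0 (fun z => z.*2.+1) p)
      (Not (ren0 0 (fun z => z.*2.+2) (ren r q)))) <->
      sat (scons y u) p /\ ~ sat (scons y w) (ren r q).
    rewrite sat_and [sat _ (Not _)]/(~ sat _ _) !sat_ren0 /=.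
    rewrite (funext (merge_even u w) : (fun z => merge u w z.*2) = u).
    by rewrite (funext (merge_odd u w) : (fun z => merge u w z.*2.+1) = w).
  by rewrite sat_ex0; split=> -[y hy]; exists y; apply/h.
have nn : sat (merge b c) (Not n).
  move=> /nE[y [py nqy]]; apply: nqy; apply: iso hp py hqc => z.
  by exists (c' z).
have : sat (merge b' c') (Not n).
  by apply: eR nn => z; rewrite /merge; case: ifP.
move=> nn'; have : sat (scons a' c') (ren r q).
  by apply: contrapT => nq; apply/nn'/nE; exists a'.
by move/sat_ren; apply: sat_eq.
Qed.

Lemma elementary_relation_bigcup M K (F : set (set (M * K))) :
  F !=set0 -> total_on F subset -> (\bigcup_(R in F) R) !=set0 ->
  (forall R, F R -> elementary_relation R) ->
  elementary_relation (\bigcup_(R in F) R).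
Proof.
move=> F0 Ftot [x0 Fx0] eF q v v' Fv hq.
pose x z := if z < vbound q then (v z, v' z) else x0.
(* The extra index [vbound q] places the default pair [x0] in [R] as well. *)
have [i|R [FR Rx]] :=
    @chain_finite _ F (vbound q).+1 (fun i => x i) F0 Ftot.
  have [R FR Rx] : (\bigcup_(R in F) R) (x i) by rewrite /x; case: ifP.
  by exists R.
have RE z : R (x z).
  case: (ltnP z (vbound q).+1) => [zq|zq]; first exact: (Rx (Ordinal zq)).
  by have := Rx ord_max; rewrite /x /= ltnn [z < _]ltnNge ltnW.
have : sat (fun z => (x z).2) q.
  apply: (eF R FR q (fun z => (x z).1)) => [z|].
    by rewrite -surjective_pairing.
  by apply: (proj1 (sat_eq_in _)) hq => z zq; rewrite /x zq.
by apply: (proj1 (sat_eq_in _)) => z zq; rewrite /x zq.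
Qed.

End Isolation.

(** * Transfinite iteration of an operation on sets *)

Section Tower.
Variables (X : Type) (base : set X) (next : set X -> set X).
Hypothesis next_sub : forall A, A `<=` next A.

(* The transfinite iterates of [next] from [base], without ordinals. *)
Inductive tower : set X -> Prop :=
| tower_next A : tower A -> tower (next A)
| tower_sup (F : set (set X)) : (forall A, F A -> tower A) ->
    tower (base `|` \bigcup_(A in F) A).

Lemma tower_base A : tower A -> base `<=` A.
Proof. by elim=> [B _ /subset_trans|F _ _ x]; [apply|left]. Qed.

(** Zermelo's comparison argument: induction on [A] and, in the successor case, a second induction
    on [B] showing that no stage lies strictly between [A] and [next A]. *)
Lemma tower_linear A B : tower A -> tower B -> A `<=` B \/ next B `<=` A.
Proof.
move=> tA; elim: tA B => {A} [A tA IHA|F tF IHF] B tB; last first.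
  have [[A [FA nAB]]|n] := pselect (exists A, F A /\ ~ (A `<=` B)).
    right; have [//|BA] := IHF A FA B tB.
    by move=> x /BA Ax; right; exists A.
  left=> x [/(tower_base tB)//|[A FA Ax]].
  by apply: contrapT => nBx; apply: n; exists A; split=> // /(_ _ Ax).
have [AB|BA] := IHA B tB; last first.
  by right; apply: subset_trans BA (@next_sub A).
suff [nAB|BA] : next A `<=` B \/ B `<=` A.
- by left.
- by right; have -> : B = A by apply/seteqP.
elim: tB AB => {B} [B tB IHB|F tF IHF] AB.
  have [AB'|BA] := IHA B tB; last by right.
  have [nAB|BA] := IHB AB'; first by left; apply: subset_trans nAB (@next_sub B).
  by left; have -> : A = B by apply/seteqP.
have [[B [FB nBA]]|n] := pselect (exists B, F B /\ ~ (B `<=` A)).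
  have [AB'|BA] := IHA B (tF _ FB); last first.
    by case: nBA; apply: subset_trans (@next_sub B) BA.
  have [nAB|//] := IHF B FB AB'.
  by left=> x /nAB Bx; right; exists B.
right=> x [/(tower_base tA)//|[B FB Bx]].
by apply: contrapT => nAx; apply: n; exists B; split=> // /(_ _ Bx).
Qed.

Definition top : set X := base `|` \bigcup_(A in tower) A.

Lemma tower_top : tower top.
Proof. exact: tower_sup. Qed.

Lemma sub_top A : tower A -> A `<=` top.
Proof. by move=> tA x Ax; right; exists A. Qed.

Lemma next_top : next top `<=` top.
Proof. exact/sub_top/tower_next/tower_top. Qed.

Lemma top_fixed A : tower A -> next A `<=` A -> top `<=` A.
Proof.
move=> tA nA x [/(tower_base tA)//|[B tB]]; move: x; rewrite -/(subset B A).
elim: tB => {B} [B tB BA|F tF IHF].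
  by have [AB|//] := tower_linear tA tB; have <- : A = B by apply/seteqP.
by move=> x [/(tower_base tA)//|[B FB]]; apply: IHF.
Qed.

End Tower.

(** The closure is the last stage of adding isolated elements to [N]. It contains all elements
    isolated over it, so density gives the Tarski-Vaught criterion. An embedding into [K] comes from
    a maximal elementary relation extending [g]. *)
Lemma SS_closure (L : language) (T : theory L) (M : structure L)
    (N : substructure M) :
  countable_language L -> SS_property T -> model T M ->
  exists (N' : structure L) (e : N -> N'), T_closure T e.
Proof.
move=> C ss mM; have [m0 Nm0] := smem_nonempty N.
have /choice[next nextP] : forall A : set M, exists B,
    (B = A /\ forall a, isolated A a -> A a) \/
    exists a, [/\ isolated A a, ~ A a & B = A `|` [set a]].
  move=> A; have [[a [ia na]]|n] := pselect (exists a, isolated A a /\ ~ A a).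
    by exists (A `|` [set a]); right; exists a.
  exists A; left; split=> // a ia; apply: contrapT => na.
  by apply: n; exists a.
have next_sub A : A `<=` next A.
  by have [[-> _]|[a [_ _ ->]]] := nextP A; [|apply: subsetUl].
pose S0 := top N next.
have NS0 : N `<=` S0 by apply: tower_base (tower_top _ _) => //.
have isoS0 a : isolated S0 a -> S0 a.
  have [[_ h]|[c [_ nc e]]] := nextP S0; first exact: h.
  by case: nc; apply: (@next_top _ N next); rewrite -/S0 e; right.
have clS0 : @fclosed L M S0.
  move=> f a Sa; exact/isoS0/(isolated_value (NS0 _ Nm0) Sa).
pose S := Substructure (ex_intro S0 m0 (NS0 _ Nm0)) clS0.
have eS : elementary_embedding (@val_of L M S).
  apply: tarski_vaught => p v Sv [d hd].
  have [y [iy hy]] := @isolated_dense L T M S p v d C ss mM Sv hd.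
  by exists y; split=> //; apply: isoS0.
pose e := inclusion (A := N) (B := S) NS0.
exists S, e; split.
- exact: (proj2 (model_elementary T eS)).
- exact: inclusion_embedding.
move=> K g mK eg.
(* The domain is required to be a stage, so that the relation is extended by exactly the element
   that [next] adds; a maximal relation then covers the closure by [top_fixed]. *)
pose P (R : set (M * K)) := [/\ tower N next (domain R), elementary_relation R &
  forall x : N, R (val_of x, g x)].
pose R0 : set (M * K) := [set xy | exists x : N, xy = (val_of x, g x)].
have [||R [[tR eR gR] Rmax]] := @Zorn_chain _ P R0.
- split; last by move=> x; exists x.
    have -> : domain R0 = N `|` \bigcup_(A in set0) A.
      rewrite bigcup_set0 setU0; apply/seteqP; split=> x.
        by move=> [y [n [-> _]]]; apply: svalP.
      by move=> Nx; exists (g (exist _ x Nx)), (exist _ x Nx).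
    exact: tower_sup.
  move=> q v v' /choice[n nE].
  have -> : v = (fun z => val_of (n z)) by apply: funext => z; have [] := nE z.
  have -> : v' = (fun z => g (n z)) by apply: funext => z; have [] := nE z.
  exact: (proj1 (SS_same_type q n ss mM mK (val_embedding N) eg)).
- move=> F [R1 FR1] FP Ftot; have [_ _ gR1] := FP _ FR1.
  have gF (x : N) : (\bigcup_(R in F) R) (val_of x, g x) by exists R1.
  split=> //.
    have -> : domain (\bigcup_(R in F) R) =
        N `|` \bigcup_(A in [set domain R | R in F]) A.
      apply/seteqP; split=> x.
        by move=> [y [R FR Rxy]]; right; exists (domain R); [exists R|exists y].
      move=> [Nx|[_ [R FR <-] [y Rxy]]]; last by exists y, R.
      by exists (g (exist _ x Nx)); apply: (gF (exist _ x Nx)).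
    by apply: tower_sup => _ [R /FP[tR _ _] <-].
  apply: elementary_relation_bigcup => //; first by exists R1.
    by exists (val_of (exist _ m0 Nm0 : N), g (exist _ m0 Nm0)).
  by move=> R /FP[].
have nR : next (domain R) `<=` domain R.
  have [[-> _]|[a [ia na nE]]] := nextP (domain R); first exact: subset_refl.
  have [a' eR'] := elementary_relation_extend eR ia.
  case: na; exists a'; apply: (Rmax (R `|` [set (a, a')])); last by right.
    exact: subsetUl.
  split=> //; last by move=> x; left.
  have -> : domain (R `|` [set (a, a')]) = next (domain R).
    rewrite nE; apply/seteqP; split=> x.
      by move=> [y [Rxy|[-> _]]]; [left; exists y|right].
    by move=> [[y Rxy]|->]; [exists y; left|exists a'; right].
  exact: tower_next.
have /choice[h hR] : forall x : S, exists y, R (val_of x, y).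
  by move=> x; apply: (top_fixed next_sub tR nR); apply: svalP.
exists h; split.
  apply: qfree_embedding => p v qp hp.
  apply: (eR p (fun z => val_of (v z))) => //.
  exact: (proj1 (sat_qfree _ (val_embedding S) qp)).
by move=> x; apply: elementary_relation_functional eR (hR (e x)) (gR x).
Qed.

(** For (ii), model completeness makes [M] itself an elementary extension of [N], so any [a] outside
    [N] serves. *)
Lemma SS_D (L : language) (T : theory L) :
  countable_language L -> SS_property T -> D_property T.
Proof.
move=> C ss; split; first by move=> M N; apply: SS_closure.
move=> M N mM mN [a Na]; exists a; split=> //.
exists M, (@val_of L M N), (@val_of L M (adjoin N a)); split=> //.
- exact: ss.2.
- exact: val_embedding.
Qed.

Theorem theorem2p7 (L : language) (T : theory L) :
  countable_language L -> (SS_property T <-> D_property T).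
Proof.
by move=> C; split; [apply: SS_D|apply: D_SS].
Qed.
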